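(* Let $n\ge2$, $t=n(n-1)/2$, $d=n(n+1)/2=n+t$, and let $G$ be a subgroup of finite index in $\mathrm{SL}_n(\mathbb{Z})$. There exists a $t$-cosharbly cocycle $\mu$ for $G$ such that $\mu(z)\neq0$ for every $z\in Sh_t$ of the form $$z=\sum_i\lambda_i[s_i]+\sum_j\kappa_j[w^{(j)}_1,\dots,w^{(j)}_d]$$ (finite sums, with $\lambda_i,\kappa_j\in\mathbb{Q}$ and each $s_i$ a $d$-dimensional simplicial cone in $C^*$ with vertices $v'$ for nonzero $v\in\mathbb{Q}^n$), where each $\lambda_i>0$, the first sum contains at least one term, and each basic sharbly $[w^{(j)}_1,\dots,w^{(j)}_d]$ in the second sum is a flipon.
   Context: **Sharbly complex.** For $k\ge0$, $Sh_k$ is the $\mathbb{Q}$-vector space generated by symbols $[v_1,\dots,v_{n+k}]$ (called basic sharblies), with $v_i$ nonzero column vectors in $\mathbb{Q}^n$, modulo the relations: (i) $[v_{\sigma(1)},\dots,v_{\sigma(n+k)}]=\mathrm{sign}(\sigma)[v_1,\dots,v_{n+k}]$ for all permutations $\sigma$; (ii) $[v_1,\dots,v_{n+k}]=0$ if the $v_i$ do not span $\mathbb{Q}^n$; (iii) $[v_1,v_2,\dots,v_{n+k}]=[av_1,v_2,\dots,v_{n+k}]$ for all $a\in\mathbb{Q}^\times$. The group $\mathrm{GL}_n(\mathbb{Q})$ acts by $g[v_1,\dots,v_{n+k}]=[gv_1,\dots,gv_{n+k}]$. The boundary $\partial:Sh_k\to Sh_{k-1}$ is $\partial[v_1,\dots,v_{n+k}]=\sum_{i}(-1)^{i+1}[v_1,\dots,\widehat{v_i},\dots,v_{n+k}]$.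 **Cosharblies.** A $t$-cosharbly for $G$ is a $G$-invariant $\mathbb{Q}$-linear map $\mu:Sh_t\to E$ for some trivial $\mathbb{Q}G$-module $E$ (equivalently, a $G$-invariant linear map on the span of the symbols vanishing on the relations (i), (ii), (iii)). It is a $t$-cosharbly cocycle if it vanishes on $\partial([v_1,\dots,v_{d+1}])$ for all nonzero $v_1,\dots,v_{d+1}\in\mathbb{Q}^n$. **Cones.** $Y$ is the space of real symmetric $n\times n$ matrices (dimension $d$) with a fixed orientation, and $C\subset Y$ the open cone of positive definite matrices. $C^*$ is the union of $C$ with all positive semidefinite symmetric matrices whose kernel is $W\otimes\mathbb{R}$ for some nonzero subspace $W\subset\mathbb{Q}^n$. For a nonzero column vector $v\in\mathbb{Q}^n$ put $v'=v\,{}^tv\in C^*$. A simplicial cone $s$ of dimension $d$ in $C^*$ with vertices $v_1',\dots,v_d'$ is the closed convex conical hull of $v_1',\dots,v_d'$, where these are linearly independent. For such $s$, $[s]=[v_1,\dots,v_d]\in Sh_t$, where the $v_i$ are listed in an order that induces on $s$ the orientation compatible with the fixed orientation of $Y$. **Flipon.** A flipon is a basic $t$-sharbly $[v_1,\dots,v_d]$ such that some affine subspace of $Y$ of dimension $d-2$ contains $v_i'$ for all $i=1,\dots,d$. *)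

(* Defs.v *)
From HB Require Import structures.
From mathcomp Require Import all_boot all_order all_algebra perm.
From mathcomp Require Import boolp classical_sets reals.
From mathcomp Require Import freeg.

Set Implicit Arguments.
Unset Strict Implicit.
Unset Printing Implicit Defensive.

Import Order.TTheory GRing.Theory Num.Theory.

Local Open Scope ring_scope.
Local Open Scope quotient_scope.

Section ModuleQuotient.
Context (K : nzRingType) (V : lmodType K) (P : V -> Prop).

Definition in_span : {pred V} := fun x =>
  `[< exists2 s : seq (K * V), (forall p, p \in s -> P p.2) &
        x = \sum_(p <- s) p.1 *: p.2 >].

Lemma in_span_gen x : P x -> x \in in_span.
Proof.
move=> Px; apply/asboolP; exists [:: (1, x)]; last by rewrite big_seq1 scale1r.
by move=> p; rewrite inE => /eqP ->.
Qed.

Lemma in_spanZ a x : x \in in_span -> a *: x \in in_span.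
Proof.
move=> /asboolP[s sP ->]; apply/asboolP.
exists [seq (a * p.1, p.2) | p <- s].
  by move=> p /mapP[q qs ->]; exact: (sP q qs).
by rewrite big_map scaler_sumr; apply: eq_bigr => p _; rewrite scalerA.
Qed.

Lemma in_span_zmod : zmod_closed in_span.
Proof.
split; first by apply/asboolP; exists [::]; rewrite ?big_nil.
move=> x y xS yS; have := in_spanZ (-1) yS; rewrite scaleN1r.
move: xS => /asboolP[s sP ->] /asboolP[r rP ->]; apply/asboolP.
exists (s ++ r); last by rewrite big_cat.
by move=> p; rewrite mem_cat => /orP[/sP|/rP].
Qed.

HB.instance Definition _ := GRing.isZmodClosed.Build V in_span in_span_zmod.

Definition modquot : Type := Quotient.quot in_span.

HB.instance Definition _ := GRing.Zmodule.on modquot.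

Definition to_modquot (x : V) : modquot := \pi_(Quotient.quot in_span) x.

Lemma to_modquot_eq x y : to_modquot x = to_modquot y <-> x - y \in in_span.
Proof.
rewrite /to_modquot Quotient.idealrBE; split; first by move=> ->.
by move/eqP.
Qed.

Lemma to_modquot_surj (q : modquot) : exists x, q = to_modquot x.
Proof. by exists (repr q); rewrite /to_modquot reprK. Qed.

Lemma to_modquotD : {morph to_modquot : x y / x + y}.
Proof. by move=> x y; rewrite /to_modquot [LHS]raddfD. Qed.

Definition modquot_scale (a : K) (q : modquot) : modquot :=
  to_modquot (a *: repr q).

Lemma to_modquotZ a x : modquot_scale a (to_modquot x) = to_modquot (a *: x).
Proof.
apply/to_modquot_eq; rewrite -scalerBr; apply: in_spanZ.
by apply/to_modquot_eq; rewrite /to_modquot reprK.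
Qed.

Fact modquot_scaleA a b q :
  modquot_scale a (modquot_scale b q) = modquot_scale (a * b) q.
Proof. by have [x ->] := to_modquot_surj q; rewrite !to_modquotZ scalerA. Qed.

Fact modquot_scale1 : left_id 1 modquot_scale.
Proof.
by move=> q; have [x ->] := to_modquot_surj q; rewrite to_modquotZ scale1r.
Qed.

Fact modquot_scaleDr : right_distributive modquot_scale +%R.
Proof.
move=> a q r; have [x ->] := to_modquot_surj q; have [y ->] := to_modquot_surj r.
by rewrite -to_modquotD !to_modquotZ scalerDr to_modquotD.
Qed.

Fact modquot_scaleDl q : {morph modquot_scale^~ q : a b / a + b}.
Proof.
move=> a b; have [x ->] := to_modquot_surj q.
by rewrite !to_modquotZ scalerDl to_modquotD.
Qed.

HB.instance Definition _ := GRing.Zmodule_isLmodule.Build K modquot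
  modquot_scaleA modquot_scale1 modquot_scaleDr modquot_scaleDl.

Lemma to_modquot_linear : linear to_modquot.
Proof. by move=> a x y; rewrite to_modquotD -to_modquotZ. Qed.

HB.instance Definition _ :=
  GRing.isLinear.Build K V modquot *:%R to_modquot to_modquot_linear.

Context (W : lmodType K) (f : {linear V -> W}) (f0 : forall x, P x -> f x = 0).

Definition modquot_lift of (forall x, P x -> f x = 0) :=
  fun q : modquot => f (repr q).

Local Notation lift := (modquot_lift f0).

Lemma modquot_lift_pi x : lift (to_modquot x) = f x.
Proof.
apply/eqP; rewrite -subr_eq0 -raddfB; apply/eqP.
have : repr (to_modquot x) - x \in in_span.
  by apply/to_modquot_eq; rewrite /to_modquot reprK.
move=> /asboolP[s sP ->]; rewrite raddf_sum big_seq big1// => p /sP /f0 pP.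
by rewrite [LHS]linearZ pP /= scaler0.
Qed.

Lemma modquot_lift_linear : linear lift.
Proof.
move=> a q r; have [x ->] := to_modquot_surj q; have [y ->] := to_modquot_surj r.
by rewrite -linearP !modquot_lift_pi linearP.
Qed.

HB.instance Definition _ :=
  GRing.isLinear.Build K modquot W *:%R lift modquot_lift_linear.

End ModuleQuotient.

Section FreeLift.
Context (K : nzRingType) (T : choiceType) (W : lmodType K) (f : T -> W).

Definition free_lift : {freeg T / K} -> W := fglift f.

Lemma free_liftE x : free_lift x = \sum_(z <- dom x) coeff z x *: f z.
Proof.
by rewrite -[in LHS](Freeg_dom x) /free_lift fglift_Freeg /prelift big_map.
Qed.

Lemma free_lift_linear : linear free_lift.
Proof.
have addf : {morph free_lift : x y / x - y} by apply: lift_is_additive.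
have add0 : free_lift 0 = 0 by rewrite -(subrr 0) addf subrr.
have addN x : free_lift (- x) = - free_lift x by rewrite -sub0r addf add0 sub0r.
have addD x y : free_lift (x + y) = free_lift x + free_lift y.
  by rewrite -[in LHS](opprK y) addf addN opprK.
move=> a x y; rewrite addD; congr (_ + _).
rewrite [a *: x]/(GRing.scale _ _) /= /fgscale.
rewrite (big_morph free_lift addD add0) free_liftE scaler_sumr.
by apply: eq_bigr => z _; rewrite /free_lift liftU scalerA.
Qed.

HB.instance Definition _ :=
  GRing.isLinear.Build K {freeg T / K} W *:%R free_lift free_lift_linear.

End FreeLift.

Record GLQ (n : nat) := MkGLQ
  { GLQ_mx :> 'M[rat]_n; GLQ_unit : GLQ_mx \in unitmx }.

HB.instance Definition _ n := [isSub for @GLQ_mx n].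
HB.instance Definition _ n := [Choice of GLQ n by <:].

Record SLZ (n : nat) := MkSLZ
  { SLZ_mx :> 'M[int]_n; SLZ_det : \det SLZ_mx == 1 }.

HB.instance Definition _ n := [isSub for @SLZ_mx n].
HB.instance Definition _ n := [Choice of SLZ n by <:].

Section SLZGroup.
Context (n : nat).
Implicit Types g h : SLZ n.

Lemma SLZ_unit g : SLZ_mx g \in unitmx.
Proof. by rewrite unitmxE (eqP (SLZ_det g)) unitr1. Qed.

Fact SLZ_one_proof : \det (1%:M : 'M[int]_n) == 1.
Proof. by rewrite det1. Qed.

Fact SLZ_inv_proof g : \det (invmx g) == 1.
Proof. by rewrite det_inv (eqP (SLZ_det g)) invr1. Qed.

Fact SLZ_mul_proof g h : \det (g *m h) == 1.
Proof. by rewrite det_mulmx (eqP (SLZ_det g)) (eqP (SLZ_det h)) mul1r. Qed.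

Definition SLZ_one : SLZ n := MkSLZ SLZ_one_proof.
Definition SLZ_inv g : SLZ n := MkSLZ (SLZ_inv_proof g).
Definition SLZ_mul g h : SLZ n := MkSLZ (SLZ_mul_proof g h).

Fact SLZ_mulA : associative SLZ_mul.
Proof. by move=> g h l; apply: val_inj; rewrite /= mulmxA. Qed.
Fact SLZ_mul1 : left_id SLZ_one SLZ_mul.
Proof. by move=> g; apply: val_inj; rewrite /= mul1mx. Qed.
Fact SLZ_mulr1 : right_id SLZ_one SLZ_mul.
Proof. by move=> g; apply: val_inj; rewrite /= mulmx1. Qed.
Fact SLZ_mulV : left_inverse SLZ_one SLZ_inv SLZ_mul.
Proof. by move=> g; apply: val_inj; rewrite /= mulVmx ?SLZ_unit. Qed.
Fact SLZ_mulrV : right_inverse SLZ_one SLZ_inv SLZ_mul.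
Proof. by move=> g; apply: val_inj; rewrite /= mulmxV ?SLZ_unit. Qed.

HB.instance Definition _ := isGroup.Build (SLZ n)
  SLZ_mulA SLZ_mul1 SLZ_mulr1 SLZ_mulV SLZ_mulrV.

Fact SLZ_GLQ_proof g : map_mx (intr : int -> rat) g \in unitmx.
Proof. by rewrite unitmxE det_map_mx (eqP (SLZ_det g)) rmorph1 unitr1. Qed.

Definition SLZ_GLQ g : GLQ n := MkGLQ (SLZ_GLQ_proof g).

End SLZGroup.

Definition finite_index (gT : groupType) (G : {pred gT}) : Prop :=
  exists s : seq gT, forall g, exists2 h, h \in s & (h^-1 * g)%g \in G.

Record nzcol (n : nat) := MkNzcol
  { nzcol_mx :> 'cV[rat]_n; nzcol_neq0 : nzcol_mx != 0 }.

HB.instance Definition _ n := [isSub for @nzcol_mx n].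
HB.instance Definition _ n := [Choice of nzcol n by <:].

Fact nzcol_mul_proof n (g : GLQ n) (v : nzcol n) : g *m v != 0.
Proof.
apply: contraNneq (nzcol_neq0 v) => gv0; apply/eqP.
by rewrite -[LHS](mulKmx (GLQ_unit g)) gv0 mulmx0.
Qed.

Definition nzcol_mul n (g : GLQ n) (v : nzcol n) : nzcol n :=
  MkNzcol (nzcol_mul_proof g v).

(* The symbols generating Sh_k. The length n + k is written k + n, so that
   k.+1 + n is definitionally (k + n).+1, which the boundary map uses. *)
Definition symbol (n k : nat) : Type := {ffun 'I_(k + n) -> nzcol n}.

HB.instance Definition _ n k := Choice.on (symbol n k).

Definition symbol_perm n k (s : 'S_(k + n)) (v : symbol n k) : symbol n k :=
  [ffun i => v (s i)].

Definition symbol_mul n k (g : GLQ n) (v : symbol n k) : symbol n k :=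
  [ffun i => nzcol_mul g (v i)].

Definition symbol_face n k (i : 'I_(k.+1 + n)) (v : symbol n k.+1) :
    symbol n k :=
  [ffun j : 'I_(k + n) => v (fintype.lift i j)].

Definition spanning n k (v : symbol n k) : bool :=
  span (codom (fun i => nzcol_mx (v i))) == fullv.

Definition gen n k (v : symbol n k) : {freeg (symbol n k) / rat} :=
  [freeg [:: (1, v)]].

Inductive sharbly_rel n k : {freeg (symbol n k) / rat} -> Prop :=
| SharblyPerm (s : 'S_(k + n)) (v : symbol n k) :
    sharbly_rel (gen (symbol_perm s v) - (-1) ^+ s *: gen v)
| SharblySpan (v : symbol n k) :
    ~~ spanning v -> sharbly_rel (gen v)
| SharblyScale (a : rat) (v w : symbol n k) :
    a != 0 ->
    (forall i : 'I_(k + n),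
       nzcol_mx (w i) = if (i : nat) == 0%N then a *: nzcol_mx (v i) else nzcol_mx (v i)) ->
    sharbly_rel (gen v - gen w).

Definition Sh (n k : nat) : Type := modquot (@sharbly_rel n k).

HB.instance Definition _ n k := GRing.Lmodule.on (Sh n k).

Definition basic n k (v : symbol n k) : Sh n k :=
  to_modquot (@sharbly_rel n k) (gen v).

Lemma free_lift_gen n k (W : lmodType rat) (f : symbol n k -> W) v :
  free_lift f (gen v) = f v.
Proof. by rewrite /free_lift liftU scale1r. Qed.

Lemma basic_rel0 n k x : sharbly_rel x -> to_modquot (@sharbly_rel n k) x = 0.
Proof.
move=> xr; rewrite -[RHS](raddf0 (to_modquot (@sharbly_rel n k))).
by apply/to_modquot_eq; rewrite subr0; exact: in_span_gen.
Qed.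

Lemma basic_perm n k s (v : symbol n k) :
  basic (symbol_perm s v) = (-1) ^+ s *: basic v.
Proof.
apply/eqP; rewrite -subr_eq0 -linearZ -raddfB; apply/eqP.
by apply: basic_rel0; exact: SharblyPerm.
Qed.

Lemma basic_span n k (v : symbol n k) : ~~ spanning v -> basic v = 0.
Proof. by move=> vs; apply: basic_rel0; exact: SharblySpan. Qed.

Lemma basic_scale n k (a : rat) (v w : symbol n k) : a != 0 ->
    (forall i : 'I_(k + n),
       nzcol_mx (w i) = if (i : nat) == 0%N then a *: nzcol_mx (v i) else nzcol_mx (v i)) ->
  basic v = basic w.
Proof.
move=> a0 vw; apply/eqP; rewrite -subr_eq0 -raddfB; apply/eqP.
by apply: basic_rel0; exact: SharblyScale a0 vw.
Qed.

Section Action.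
Context (n k : nat) (g : GLQ n).

Lemma spanning_mul (v : symbol n k) : spanning (symbol_mul g v) -> spanning v.
Proof.
rewrite /spanning => /eqP gv; rewrite eqEsubv subvf /=; apply/subvP => x _.
have : (g : 'M_n) *m x \in span (codom (fun i => nzcol_mx (symbol_mul g v i))).
  by rewrite gv memvf.
move=> /(memv_img (linfun (mulmx (invmx g)))).
rewrite lfunE /= mulKmx ?GLQ_unit // limg_span; apply/subvP/sub_span => y.
move=> /mapP[z /codomP[i ->] ->]; rewrite lfunE /= ffunE /= mulKmx ?GLQ_unit //.
exact: codom_f.
Qed.

Lemma sharbly_act_rel x :
  sharbly_rel x -> free_lift (fun v : symbol n k => basic (symbol_mul g v)) x = 0.
Proof.
case=> [s v|v vs|a v w a0 vw].
- rewrite raddfB [X in _ - X]linearZ /= !free_lift_gen -basic_perm.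
  suff -> : symbol_mul g (symbol_perm s v) = symbol_perm s (symbol_mul g v).
    by rewrite subrr.
  by apply/ffunP => i; rewrite !ffunE.
- by rewrite free_lift_gen basic_span //; apply: contra vs; exact: spanning_mul.
- rewrite raddfB /= !free_lift_gen (basic_scale (w := symbol_mul g w) a0) ?subrr//.
  by move=> i; rewrite !ffunE /= vw; case: ifP => // _; rewrite scalemxAr.
Qed.

Definition sharbly_act : Sh n k -> Sh n k := modquot_lift sharbly_act_rel.

HB.instance Definition _ := GRing.Linear.on sharbly_act.

Lemma sharbly_act_basic v : sharbly_act (basic v) = basic (symbol_mul g v).
Proof. by rewrite /sharbly_act /basic modquot_lift_pi /= free_lift_gen. Qed.

End Action.

Section Boundary.
Context (n k : nat).

Definition boundary_symbol (v : symbol n k.+1) : Sh n k :=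
  \sum_(i < (k + n).+1) (-1) ^+ i *: basic (symbol_face i v).

Lemma spanning_face i (v : symbol n k.+1) :
  spanning (symbol_face i v) -> spanning v.
Proof.
rewrite /spanning => /eqP fv; rewrite eqEsubv subvf /= -fv; apply: sub_span.
by move=> x /codomP[j ->]; rewrite ffunE; exact: codom_f.
Qed.

Lemma perm_unlift (m : nat) (s : 'S_m.+1) (i : 'I_m.+1) :
  exists t : 'S_m, s = lift_perm i (s i) t.
Proof.
pose f (j : 'I_m) := odflt j (unlift (s i) (s (fintype.lift i j))).
have fE j : fintype.lift (s i) (f j) = s (fintype.lift i j).
  rewrite /f; have : s i != s (fintype.lift i j).
    by rewrite (inj_eq perm_inj) neq_lift.
  by case/unlift_some => l -> ->.
have f_inj : injective f.
  by move=> j l /(congr1 (fintype.lift (s i))); rewrite !fE => /perm_inj/lift_inj.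
exists (perm f_inj); apply/permP => j; case: (unliftP i j) => [l ->|->].
  by rewrite lift_perm_lift permE fE.
by rewrite lift_perm_id.
Qed.

Lemma boundary_rel x : sharbly_rel x -> free_lift boundary_symbol x = 0.
Proof.
case=> [s v|v vs|a v w a0 vw].
- rewrite raddfB [X in _ - X]linearZ /= !free_lift_gen; apply/eqP; rewrite subr_eq0; apply/eqP.
  rewrite /boundary_symbol scaler_sumr [RHS](reindex_inj (@perm_inj _ s)) /=.
  apply: eq_bigr => i _; have [t st] := @perm_unlift (k + n) s i.
  have -> : symbol_face i (symbol_perm s v) = symbol_perm t (symbol_face (s i) v).
    by apply/ffunP => j; rewrite !ffunE {1}st lift_perm_lift.
  rewrite basic_perm !scalerA; congr (_ *: _).
  have -> : odd_perm s = odd i (+) odd (s i) (+) odd_perm t.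
    by rewrite {1}st odd_lift_perm.
  rewrite -[(-1) ^+ i]signr_odd -[(-1) ^+ s i]signr_odd.
  by case: (odd i); case: (odd (s i)); case: (odd_perm t);
     rewrite ?mulr1 ?mul1r ?mulrNN.
- rewrite free_lift_gen /boundary_symbol big1 // => i _.
  rewrite basic_span ?scaler0 //; apply: contra vs; exact: spanning_face.
- rewrite raddfB /= !free_lift_gen; apply/eqP; rewrite subr_eq0; apply/eqP.
  apply: eq_bigr => i _; congr (_ *: _).
  have [i0|i0] := eqVneq (i : nat) 0%N.
    congr basic; apply/ffunP => j; rewrite !ffunE; apply: val_inj => /=.
    by rewrite vw /= /bump i0.
  apply: (basic_scale a0) => j; rewrite !ffunE vw /= /bump.
  by case: (nat_of_ord j) => [|l]; rewrite ?addnS // leqn0 (negbTE i0).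
Qed.

Definition boundary : Sh n k.+1 -> Sh n k := modquot_lift boundary_rel.

HB.instance Definition _ := GRing.Linear.on boundary.

Lemma boundary_basic v :
  boundary (basic v) = \sum_(i < (k + n).+1) (-1) ^+ i *: basic (symbol_face i v).
Proof. by rewrite /boundary /basic modquot_lift_pi /= free_lift_gen. Qed.

End Boundary.

Definition cosharbly n k (G : {pred SLZ n}) (E : lmodType rat)
    (mu : {linear Sh n k -> E}) : Prop :=
  forall g, g \in G -> forall x, mu (sharbly_act (SLZ_GLQ g) x) = mu x.

Definition cocycle n k (E : lmodType rat) (mu : {linear Sh n k -> E}) : Prop :=
  forall v : symbol n k.+1, mu (boundary (basic v)) = 0.

Section Cones.
Local Open Scope classical_set_scope.
Context (R : realType) (n : nat).

Definition symmx : {vspace 'M[R]_n} := fixedSpace (linfun (@trmx R n n)).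

Lemma symmxP (A : 'M[R]_n) : reflect (A^T = A) (A \in symmx).
Proof. by apply: (iffP fixedSpaceP); rewrite lfunE. Qed.

Definition posdef : set 'M[R]_n :=
  [set A | A \in symmx /\
     forall x : 'cV[R]_n, x != 0 -> 0 < (x^T *m A *m x) 0 0].

Definition possemidef : set 'M[R]_n :=
  [set A | A \in symmx /\ forall x : 'cV[R]_n, 0 <= (x^T *m A *m x) 0 0].

(* Subspaces of Q^n are given as row spaces of rational matrices W; for
   symmetric A the left kernel kermx A is the kernel of A, transposed. *)
Definition Cstar : set 'M[R]_n :=
  posdef `|` [set A | possemidef A /\
    exists2 W : 'M[rat]_n, W != 0 & (kermx A == map_mx ratr W)%MS].

Definition vprime (v : nzcol n) : 'M[R]_n :=
  map_mx ratr (nzcol_mx v) *m (map_mx ratr (nzcol_mx v))^T.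

Definition conical_hull m (A : 'I_m -> 'M[R]_n) : set 'M[R]_n :=
  [set B | exists2 c : 'I_m -> R,
     (forall i, 0 <= c i) & B = \sum_(i < m) c i *: A i].

Definition simplicial_cone k (s : set 'M[R]_n) (v : symbol n k) : Prop :=
  [/\ free [tuple vprime (v i) | i < k + n],
      s = conical_hull (fun i => vprime (v i)) & s `<=` Cstar].

(* The fixed orientation of the space of symmetric matrices is that of an
   ordered basis e. *)
Definition positively_oriented k (e : (k + n).-tuple 'M[R]_n)
    (v : symbol n k) : Prop :=
  0 < \det (\matrix_(i, j) coord e j (vprime (v i))).

(* x is [s]: the vertices of the simplicial cone s, listed in an order
   compatible with the orientation e, form a symbol v with x = [v]. *)
Definition cone_sharbly k (e : (k + n).-tuple 'M[R]_n)
    (s : set 'M[R]_n) (x : Sh n k) : Prop :=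
  exists v : symbol n k,
    [/\ simplicial_cone s v, positively_oriented e v & x = basic v].

Definition flipon k (v : symbol n k) : Prop :=
  exists (p : 'M[R]_n) (U : {vspace 'M[R]_n}),
    [/\ p \in symmx, (U <= symmx)%VS, \dim U = (k + n - 2)%N &
        forall i, vprime (v i) - p \in U].

End Cones.

Definition tdeg (n : nat) : nat := (n * n.-1)./2.

Lemma tdeg_dim n : (tdeg n + n = (n * n.+1)./2)%N.
Proof.
case: n => [//|n]; have -> : (n.+1 * n.+2 = n.+1 * n + n.+1.*2)%N.
  by rewrite -muln2 -mulnDr addn2.
by rewrite halfD odd_double andbF doubleK.
Qed.

(* Main.v *)
From HB Require Import structures.
Require Import Defs.
From mathcomp Require Import all_boot all_order all_algebra perm.
From mathcomp Require Import finmap boolp classical_sets functions cardinality.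
From mathcomp Require Import fsbigop reals constructive_ereal lebesgue_measure.
From mathcomp Require Import freeg polyrcf ring lra zify.

Set Implicit Arguments.
Unset Strict Implicit.
Unset Printing Implicit Defensive.

Import Order.TTheory GRing.Theory Num.Theory.
Local Open Scope ring_scope.

(** The cocycle counts lattice translates. Fix a real symmetric matrix [x] and
  send [[v_1, ..., v_d]] to the number of [g] in [G] for which [g x g^T] lies
  in the open cone spanned by the [v_i'], with the sign of the orientation of
  that cone. The values for all suitable [x] are collected in a function of
  [x], and such functions form the target of [mu].

  The count is finite ([finite_translates]) when the form [x] is bounded below
  by a positive constant on nonzero integer vectors. If
  [g x g^T = \sum_i c_i v_i'], the [v_i] whose coefficient [c_i] is not tiny
  must span the whole space: otherwise an integer vector [y] orthogonal to
  them would make [x] tiny at the nonzero integer vector [g^T y]. For those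
  [i], the identity [x = \sum_i c_i (g^-1 v_i)'] bounds [g^-1 v_i] by the
  diagonal entries of [x], so that the integer matrix [g^-1] is bounded.

  The count kills boundaries when [x] is generic, that is, in no subspace
  spanned by fewer than [d] matrices [v']. Indeed, if [d + 1] of the [v'] span
  the symmetric matrices, the ways of writing [x] as a combination of them
  form a line, directed by their unique linear relation. This line meets the
  orthant of nonnegative coefficients in a segment, which is bounded because
  all the [v'] have positive trace; genericity makes each end of it lie in the
  interior of exactly one facet of the orthant. The facets through which the
  line enters and leaves are the two cones of the boundary that contain [x],
  and they come with opposite signs ([sum_in_facet], [cone_sign_boundary]).

  The count is [G]-invariant because conjugation by a matrix of positive
  determinant preserves the orientation of the space of symmetric matrices
  ([orient_act_gt0]). A flipon has linearly dependent [v_i'], hence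
  orientation [0], and the count is nonnegative on every positively oriented
  cone. Finally the open cone of [s_1] contains a generic [x]
  ([generic_in_cone]) bounded below on integer vectors
  ([cone_lattice_positive]). At this [x], the identity of [G] already
  contributes [1] to the count of [s_1], so the value of [mu] is positive. *)

(** * Multiplicative functions of matrices and the sign of the determinant *)

Lemma sqnorm_gt0 (R : realDomainType) n (w : 'cV[R]_n) : w != 0 -> 0 < (w^T *m w) 0 0.
Proof.
move=> w0; rewrite mxE.
have [i wi] : exists i, w i 0 != 0.
  apply/existsP; apply: contraNT w0 => /existsPn w0; apply/eqP/colP => i.
  by rewrite mxE; apply/eqP; rewrite -[_ == _]negbK w0.
rewrite (bigD1 i) //= ltr_pwDl //.
  by rewrite mxE -expr2 exprn_even_gt0.
by apply: sumr_ge0 => j _; rewrite mxE -expr2 sqr_ge0.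
Qed.

Section MultiplicativeSign.
Context (R : rcfType) (m : nat).
Local Notation n := m.+1.
Context (P : 'M[R]_n -> R).
Context (P1 : P 1%:M = 1).
Context (PM : forall A B, P (A *m B) = P A * P B).
Context (P_poly : forall M : 'M[{poly R}]_n,
  exists p : {poly R}, forall t, P (map_mx (horner^~ t) M) = p.[t]).

Lemma mulsign_neq0 A : A \in unitmx -> P A != 0.
Proof.
move=> uA; have : P A * P (invmx A) != 0 by rewrite -PM mulmxV // P1 oner_neq0.
by apply: contra => /eqP ->; rewrite mul0r.
Qed.

Lemma mulsign_sqr A : A \in unitmx -> 0 < P (A *m A).
Proof. by move=> /mulsign_neq0 PA; rewrite PM lt0r mulf_neq0 //= -expr2 sqr_ge0. Qed.

(** [P] cannot vanish on invertible matrices, so by the intermediate value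
  theorem it keeps its sign along a polynomial path of invertible matrices. *)
Lemma mulsign_path (M : 'M[{poly R}]_n) :
  (forall t, 0 <= t <= 1 -> map_mx (horner^~ t) M \in unitmx) ->
  0 < P (map_mx (horner^~ 0) M) * P (map_mx (horner^~ 1) M).
Proof.
move=> uM; have [p pE] := P_poly M.
rewrite ltNge; apply/negP; rewrite !pE => /(polyrcf.poly_ivt ler01)[x].
rewrite in_itv /= => /uM/mulsign_neq0; rewrite pE => px0 /rootP px.
by rewrite px eqxx in px0.
Qed.

(** The path is the segment from [A] to [B]. This is used when [B] is triangular
  and [A] is its diagonal. *)
Lemma mulsign_diag (A B : 'M[R]_n) :
    (forall t, \det (A + t *: (B - A)) = \det A) -> A \in unitmx ->
  0 < P A * P B.
Proof.
move=> detAB uA.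
have E t : map_mx (horner^~ t) (map_mx polyC A + 'X *: map_mx polyC (B - A))
   = A + t *: (B - A).
  by apply/matrixP => i j; rewrite !mxE !hornerE.
have := @mulsign_path (map_mx polyC A + 'X *: map_mx polyC (B - A)).
rewrite !E scale0r addr0 scale1r subrKC => -> //.
by move=> t _; rewrite E unitmxE detAB -unitmxE.
Qed.

(** The reflection in the hyperplane orthogonal to [w], multiplied by the squared
  norm of [w] so that its entries are polynomials in [w]. *)
Definition reflmx (w : 'cV[R]_n) : 'M[R]_n := (w^T *m w) 0 0 *: 1%:M - 2 *: (w *m w^T).

Lemma reflmx_unit w : w != 0 -> reflmx w \in unitmx.
Proof.
move=> /sqnorm_gt0 w0; set N := (w^T *m w) 0 0 in w0 *.
suff : reflmx w *m reflmx w = (N ^+ 2)%:M.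
  move=> /(congr1 determinant); rewrite det_mulmx det_scalar unitmxE unitfE.
  by move=> H; apply: contra_eq_neq H => ->; rewrite mul0r eq_sym !expf_neq0 // gt_eqF.
have wwE : w *m w^T *m (w *m w^T) = N *: (w *m w^T).
  by rewrite mulmxA -(mulmxA w) [w^T *m w]mx11_scalar -/N mul_mx_scalar scalemxAl.
rewrite /reflmx -/N scalemx1 mulmxBl !mulmxBr -!scalar_mxM.
rewrite -!scalemxAr -!scalemxAl wwE mul_scalar_mx mul_mx_scalar.
rewrite !scalerA -expr2.
set Q := w *m w^T; apply/matrixP => i j; rewrite !mxE; ring.
Qed.

(** All reflections give [P] the same sign, because they move continuously into
  one another; this is how one constant governs all matrices of negative
  determinant. *)
Lemma mulsign_refl v w : (forall t, v + t *: (w - v) != 0) ->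
  0 < P (reflmx v) * P (reflmx w).
Proof.
move=> vw0; pose x : 'cV_n := map_mx polyC v + 'X *: map_mx polyC (w - v).
have xE t : map_mx (horner^~ t) x = v + t *: (w - v).
  by apply/matrixP => i j; rewrite !mxE !hornerE.
have E t : map_mx (horner^~ t) ((x^T *m x) 0 0 *: 1%:M - 2 *: (x *m x^T))
   = reflmx (v + t *: (w - v)).
  rewrite -xE; apply/matrixP => i j; rewrite !mxE !hornerE hornerMn !horner_sum.
  rewrite (hornerC 1); congr (_ * _ - _ * _);
    by apply: eq_bigr => k _; rewrite hornerM !mxE.
have := @mulsign_path ((x^T *m x) 0 0 *: 1%:M - 2 *: (x *m x^T)).
rewrite !E scale0r addr0 scale1r subrKC; apply => t _.
by rewrite E reflmx_unit.
Qed.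

(** [c] stands for the value of [P] at a reflection: the sign of [P A] must be
  that of [1] or of [c], as for a power of the determinant. *)
Definition sign_follows_det (c : R) (A : 'M[R]_n) :=
  A \in unitmx /\ 0 < P A * (if \det A < 0 then c else 1).

Lemma sign_follows_detM c A B : c != 0 ->
  sign_follows_det c A -> sign_follows_det c B -> sign_follows_det c (A *m B).
Proof.
move=> c0 [uA PA] [uB PB]; split; first by rewrite unitmx_mul uA.
rewrite PM det_mulmx.
have := mulr_gt0 PA PB; have cc : 0 < c ^+ 2 by rewrite exprn_even_gt0.
move: uA uB; rewrite !unitmxE !unitfE !neq_lt => /orP[dA|dA] /orP[dB|dB].
- have dAB : \det A * \det B < 0 = false by apply/negbTE; rewrite -leNgt ltW // nmulr_rgt0.
  rewrite dA dB dAB mulr1.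
  by rewrite mulrACA -expr2 pmulr_lgt0.
- by rewrite dA [\det B < 0]ltNge (ltW dB) /= nmulr_rlt0 // dB mulr1 mulrAC.
- by rewrite dB [\det A < 0]ltNge (ltW dA) /= pmulr_rlt0 // dB mulr1 mulrA.
- rewrite ![_ < 0]ltNge (ltW dA) (ltW dB) (ltW (mulr_gt0 dA dB)) /=.
  by rewrite !mulr1.
Qed.

Lemma sign_follows_det_sqr c A : A \in unitmx -> sign_follows_det c (A *m A).
Proof.
move=> uA; split; first by rewrite unitmx_mul uA.
by rewrite det_mulmx -expr2 [_ ^+ 2 < 0]ltNge sqr_ge0 /= mulr1 mulsign_sqr.
Qed.

(** Each negative entry is turned positive by a coordinate reflection, and a
  positive diagonal matrix is a square. *)
Lemma sign_follows_det_diag (c : R) : c != 0 ->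
    (forall i, 0 < c * P (reflmx (delta_mx i 0))) ->
  forall d : 'rV[R]_n, (forall i, d 0 i != 0) -> sign_follows_det c (diag_mx d).
Proof.
move=> c0 cP d; have [b] := ubnP #|[pred i | d 0 i < 0]|.
elim: b d => // b IH d /ltnSE dm d0.
have [neg|nneg] := pickP [pred i | d 0 i < 0]; last first.
  pose r := \row_i Num.sqrt (d 0 i).
  have -> : diag_mx d = diag_mx r *m diag_mx r.
    rewrite mulmx_diag; congr diag_mx; apply/rowP => i.
    by rewrite !mxE -expr2 sqr_sqrtr // leNgt; have /= -> := nneg i.
  apply: sign_follows_det_sqr; rewrite unitmxE det_diag unitfE.
  apply/prodf_neq0 => i _; rewrite mxE sqrtr_eq0 -ltNge lt_def d0.
  by rewrite leNgt; have /= -> := nneg i.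
move=> /= negd; pose d' := \row_i (if i == neg then - d 0 i else d 0 i).
have rE : reflmx (delta_mx neg 0) = diag_mx (\row_i (if i == neg then -1 else 1)).
  apply/matrixP => i j; rewrite !mxE big_ord1 (bigD1 neg) //= big1 => [|k /negbTE nk].
    rewrite !mxE !eqxx eq_sym mulr1 addr0 mul1r; have [->|ij] := eqVneq i j.
      by case: eqP => //= _; rewrite -mulr_natr; ring.
    case: (eqVneq i neg) ij => [->|_] ij; rewrite ?mul0r ?mulr0 ?subr0 //=.
    by rewrite eq_sym (negbTE ij) !mulr0 subr0.
  by rewrite !mxE nk mul0r.
have -> : diag_mx d = reflmx (delta_mx neg 0) *m diag_mx d'.
  rewrite rE mulmx_diag; congr diag_mx; apply/rowP => i.
  by rewrite !mxE; case: eqP; rewrite ?mulrNN mul1r.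
apply: sign_follows_detM => //.
  split.
    apply: reflmx_unit; apply/negP => /eqP/matrixP/(_ neg 0)/eqP.
    by rewrite !mxE !eqxx oner_eq0.
  rewrite rE det_diag (bigD1 neg) //= big1 ?mulr1 => [|i /negbTE ni]; rewrite !mxE ?ni //.
  by rewrite eqxx ltrN10 mulrC -rE.
apply: IH => [|i]; last by rewrite mxE; case: ifP; rewrite ?oppr_eq0 d0.
apply: leq_trans dm; apply: proper_card; apply/properP; split.
  apply/fintype.subsetP => i; rewrite !inE mxE; case: eqP => // ->.
  by rewrite oppr_lt0 ltNge ltW.
by exists neg; rewrite !inE ?negd // mxE eqxx oppr_lt0 -leNgt ltW.
Qed.

Lemma reflmx_tperm (i j : 'I_n) : i != j ->
  reflmx (delta_mx i 0 - delta_mx j 0) = 2%:M *m tperm_mx i j.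
Proof.
move=> ij; apply/matrixP => a b.
have E x : (x^T *m x) 0 0 = \sum_k x k 0 ^+ 2 :> R.
  by rewrite mxE; apply: eq_bigr => k _; rewrite mxE expr2.
rewrite /reflmx E (bigD1 i) //= (bigD1 j) 1?eq_sym //= big1 => [|k /andP[/negbTE ki /negbTE kj]]; last first.
  by rewrite !mxE ki kj subrr expr0n.
rewrite mul_scalar_mx !mxE big_ord1 !mxE !eqxx !andbT (negbTE ij) [j == i]eq_sym (negbTE ij).
rewrite permE /=.
case: (eqVneq a i) => [->|ai]; case: (eqVneq b i) => [->|bi]; rewrite ?eqxx.
- rewrite [j == i]eq_sym (negbTE ij) /=; ring.
- rewrite [j == b]eq_sym (negbTE ij); case: (b == j); rewrite /=; ring.
- case: (eqVneq a j) => [->|aj]; rewrite ?eqxx ?(negbTE ai) (negbTE ij) ?[j == i]eq_sym ?(negbTE ij); rewrite /=; ring.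
- case: (eqVneq a j) => [->|aj]; rewrite ?[j == b]eq_sym ?[i == b]eq_sym ?(negbTE bi) ?(negbTE aj).
    by case: (b == j); rewrite /=; ring.
  by case: (a == b); rewrite /=; ring.
Qed.

(** The group of matrices of positive determinant is connected. Concretely, an
  LUP decomposition reduces the sign of [P A] to permutations, which are
  products of reflections by [reflmx_tperm], and to triangular matrices, which
  deform to their diagonals. *)
Lemma mulsign_gt0 A : 0 < \det A -> 0 < P A.
Proof.
move=> dA; pose c := P (reflmx (delta_mx 0 0)).
have e0 (i : 'I_n) : delta_mx i 0 != 0 :> 'cV[R]_n.
  by apply/negP => /eqP /matrixP /(_ i 0)/eqP; rewrite !mxE !eqxx oner_eq0.
have c0 : c != 0 by apply/mulsign_neq0/reflmx_unit.
have cP i : 0 < c * P (reflmx (delta_mx i 0)).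
  have [->|i0] := eqVneq i 0; first by rewrite -expr2 exprn_even_gt0.
  apply: mulsign_refl => t; apply/negP => /eqP/matrixP H.
  have /eqP := H i 0; have /eqP := H 0 0; rewrite !mxE !eqxx (negbTE i0) [0 == i]eq_sym (negbTE i0) /=.
  by move=> /eqP t1 /eqP t2; move: t1; rewrite mulr1n mulr0n; lra.
have diagP := sign_follows_det_diag c0 cP.
have id1 : sign_follows_det c 1%:M.
  by rewrite -[1%:M]mulmx1; apply: sign_follows_det_sqr; rewrite unitmx1.
have trigP (B T : 'M[R]_n) : (forall t, \det (B + t *: (T - B)) = \det B) ->
    \det T = \det B -> sign_follows_det c B -> sign_follows_det c T.
  move=> detBT detT [uB PB]; split; first by rewrite unitmxE detT -unitmxE.
  have := mulsign_diag detBT uB; rewrite detT; move: PB.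
  have B2 : 0 < P B ^+ 2 by rewrite exprn_even_gt0 ?mulsign_neq0.
  set x := (if _ then _ else _) => PB PBT; rewrite -(pmulr_rgt0 _ B2).
  have -> : P B ^+ 2 * (P T * x) = (P B * x) * (P B * P T) by ring.
  exact: mulr_gt0.
have tpermP (i j : 'I_n) : sign_follows_det c (tperm_mx i j).
  have [->|ij] := eqVneq i j; first by rewrite /tperm_mx tperm1 perm_mx1.
  have P2 : 0 < P 2%:M.
    have -> : 2%:M = (Num.sqrt 2)%:M *m (Num.sqrt 2)%:M :> 'M[R]_n.
      by rewrite -scalar_mxM -expr2 sqr_sqrtr ?ler0n.
    by apply: mulsign_sqr; rewrite unitmxE det_scalar unitfE expf_neq0 // sqrtr_eq0 -ltNge ltr0n.
  split; first exact: unitmx_perm.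
  rewrite det_perm odd_tperm ij expr1 ltrN10.
  have : 0 < P (reflmx (delta_mx i 0)) * P (reflmx (delta_mx i 0 - delta_mx j 0)).
    apply: mulsign_refl => t; apply/negP => /eqP/matrixP H.
    have /eqP := H j 0; have /eqP := H i 0; rewrite !mxE !eqxx (negbTE ij) [j == i]eq_sym (negbTE ij) /=.
    by rewrite mulr1n mulr0n => /eqP t1 /eqP t2; move: t1; lra.
  have := cP i; set u := P (reflmx (delta_mx i 0)) => cu.
  have u0 : 0 < u ^+ 2 by rewrite exprn_even_gt0 //; apply: contraTneq cu => ->; rewrite mulr0 ltxx.
  rewrite reflmx_tperm // PM => H; rewrite -(pmulr_rgt0 _ (mulr_gt0 P2 u0)).
  set p := P (tperm_mx i j) in H *.
  have -> : P 2%:M * u ^+ 2 * (p * c) = (c * u) * (u * (P 2%:M * p)) by ring.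
  exact: mulr_gt0.
have permP (s : 'S_n) : sign_follows_det c (perm_mx s).
  have [ts -> _] := prod_tpermP s; elim: ts => [|t ts IH]; first by rewrite big_nil perm_mx1.
  rewrite big_cons perm_mxM; exact: (sign_follows_detM c0 (tpermP _ _) IH).
suff [_] : sign_follows_det c A by rewrite [_ < 0]ltNge (ltW dA) mulr1.
have := cormen_lup_detL A; have := cormen_lup_perm A; have := cormen_lup_correct A.
have := @cormen_lup_upper _ _ A; have := @cormen_lup_lower _ _ A.
case: (cormen_lup A) => [[Q L] U] /= Llow Uup QA /is_perm_mxP[s Qs] detL.
have -> : A = perm_mx s^-1 *m (L *m U).
  by rewrite mulmxE -QA Qs -mulmxE mulmxA -perm_mxM mulVg perm_mx1 mul1mx.
have ltF (i j : 'I_n) : (i < j)%N -> (i == j) = false.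
  by move=> ij; apply/eqP => E; rewrite E ltnn in ij.
have uU : \det U != 0.
  apply: contraTneq dA => U0; move: (congr1 determinant QA).
  rewrite -mulmxE det_mulmx [RHS]det_mulmx U0 mulr0 Qs det_perm => /eqP.
  by rewrite mulf_eq0 signr_eq0 => /eqP ->; rewrite ltxx.
have detU : \det U = \prod_i U i i.
  rewrite -det_tr det_trig; first by apply: eq_bigr => i _; rewrite mxE.
  by apply/is_trig_mxP => i j ij; rewrite mxE Uup.
pose D := diag_mx (\row_i U i i).
have detD : \det U = \det D.
  by rewrite detU det_diag; apply: eq_bigr => i _; rewrite mxE.
apply: sign_follows_detM => //; apply: sign_follows_detM => //.
  apply: (trigP 1%:M) => //; last by rewrite det1.
  move=> t; rewrite det1 det_trig ?big1 // => [i _|].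
    by rewrite !mxE Llow // eqxx subrr mulr0 addr0.
  by apply/is_trig_mxP => i j ij; rewrite !mxE (Llow _ _ (ltnW ij)) (ltF _ _ ij) subrr mulr0 addr0.
apply: (trigP D) => //; last first.
  apply: diagP => i; rewrite mxE; move: uU; rewrite detU => /prodf_neq0; exact.
move=> t; rewrite -detD detU -det_tr det_trig.
  by apply: eq_bigr => i _; rewrite !mxE eqxx subrr mulr0 addr0.
by apply/is_trig_mxP => i j ij; rewrite /D !mxE (Uup _ _ ij) eq_sym (ltF _ _ ij) subrr mulr0 addr0.
Qed.

End MultiplicativeSign.

(** * Orientation of families of symmetric matrices *)

(** The action on quadratic forms for which [(g v)' = g v' g^T]. *)
Definition act (R : pzRingType) (n : nat) (g x : 'M[R]_n) : 'M[R]_n := g *m x *m g^T.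

Arguments act {R n} g x : simpl never.

Section Orient.
Context (R : realType) (n d : nat) (e : d.-tuple 'M[R]_n)
  (e_basis : basis_of (symmx R n) e).

(** The determinant of the family [a] in the basis [e]: nonzero exactly on bases
  of the symmetric matrices, and positive on those oriented as [e]. *)
Definition orient (a : 'I_d -> 'M[R]_n) : R := \det (\matrix_(i, j) coord e j (a i)).

Lemma coord_mulmx (a : 'I_d -> 'M[R]_n) (c : 'I_d -> R) j :
  coord e j (\sum_i c i *: a i) = ((\row_i c i) *m \matrix_(i, j) coord e j (a i)) 0 j.
Proof. by rewrite linear_sum mxE; apply: eq_bigr => i _; rewrite linearZ !mxE. Qed.

Lemma orient_free a (c : 'I_d -> R) : orient a != 0 ->
  \sum_i c i *: a i = 0 -> forall i, c i = 0.
Proof.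
move=> a0 ca0 i; pose M := \matrix_(i, j) coord e j (a i).
have uM : M \in unitmx by rewrite unitmxE unitfE.
have : (\row_i c i) *m M = 0 by apply/rowP => j; rewrite -coord_mulmx ca0 linear0 mxE.
move=> /(congr1 (mulmx^~ (invmx M))); rewrite mulmxK // mul0mx => /rowP/(_ i).
by rewrite !mxE.
Qed.

Lemma eq_coord x y : x \in symmx R n -> y \in symmx R n ->
  (forall j, coord e j x = coord e j y) -> x = y.
Proof.
move=> xS yS xy; rewrite (coord_basis e_basis xS) (coord_basis e_basis yS).
by apply: eq_bigr => j _; rewrite xy.
Qed.

Lemma orient_span a y : (forall i, a i \in symmx R n) -> orient a != 0 ->
  y \in symmx R n -> exists c : 'I_d -> R, y = \sum_i c i *: a i.
Proof.
move=> aS a0 yS; pose M := \matrix_(i, j) coord e j (a i).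
have uM : M \in unitmx by rewrite unitmxE unitfE.
pose c := (\row_j coord e j y) *m invmx M.
exists (c 0); apply: eq_coord => // [|j].
  by apply: rpred_sum => i _; apply: rpredZ.
rewrite coord_mulmx (_ : \row_i c 0 i = c); last by apply/rowP => i; rewrite mxE.
by rewrite mulmxKV // mxE.
Qed.

Lemma orient_linear (f : {linear 'M[R]_n -> 'M[R]_n}) (a : 'I_d -> 'M[R]_n) :
  (forall i, a i \in symmx R n) ->
  orient (f \o a) = orient a * orient (fun i => f e`_i).
Proof.
move=> aS; rewrite /orient -det_mulmx; congr (\det _); apply/matrixP => i j.
rewrite !mxE /= [in LHS](coord_basis e_basis (aS i)) !linear_sum.
by apply: eq_bigr => l _; rewrite !linearZ !mxE.
Qed.

Lemma dim_symmx : \dim (symmx R n) = d.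
Proof. exact: size_basis e_basis. Qed.

Lemma orient_subspace a (V : {vspace 'M[R]_n}) : (forall i, a i \in symmx R n) ->
  (forall i, a i \in V) -> (\dim V < d)%N -> orient a = 0.
Proof.
move=> aS aV; apply: contraTeq => a0; rewrite -leqNgt -dim_symmx.
apply/dimvS/subvP => y /(orient_span aS a0)[c ->].
by apply: rpred_sum => i _; apply: rpredZ.
Qed.

(** Cramer's relation between [d + 1] vectors in dimension [d]: repeating one
  coordinate column in the matrix of their coordinates gives a square matrix of
  determinant zero, and this determinant is expanded along the extra column. *)
Lemma orient_cramer (a : 'I_d.+1 -> 'M[R]_n) : (forall i, a i \in symmx R n) ->
  \sum_(i < d.+1) ((-1) ^+ i * orient (a \o fintype.lift i)) *: a i = 0.
Proof.
move=> aS; apply: eq_coord; rewrite ?mem0v //.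
  by apply: rpred_sum => i _; apply: rpredZ.
move=> j; rewrite linear0 linear_sum.
pose A := \matrix_(i < d.+1, l < d.+1)
  coord e (if unlift 0 l is Some l' then l' else j) (a i).
have : \det A = 0.
  rewrite -det_tr; apply: (@determinant_alternate _ _ _ 0 (fintype.lift 0 j)) => [|i].
    by rewrite neq_lift.
  by rewrite !mxE unlift_none liftK.
move=> detA; rewrite -[RHS]detA (expand_det_col A 0); apply: eq_bigr => i _.
rewrite linearZ /= mxE unlift_none mulrC; congr (_ * _).
rewrite /cofactor addn0; congr (_ * \det _).
by apply/matrixP => p q; rewrite !mxE liftK.
Qed.

Lemma act_sym g x : x \in symmx R n -> act g x \in symmx R n.
Proof. by move=> /symmxP xS; apply/symmxP; rewrite /act !trmx_mul trmxK xS mulmxA. Qed.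

End Orient.

Lemma act_linear_subproof (R : comPzRingType) n (g : 'M[R]_n) : linear (act g).
Proof. by move=> c x y; rewrite /act mulmxDr mulmxDl -scalemxAr -scalemxAl. Qed.
HB.instance Definition _ (R : comPzRingType) n (g : 'M[R]_n) :=
  GRing.isLinear.Build R 'M[R]_n 'M[R]_n *:%R (act g) (act_linear_subproof g).

Lemma actM (R : comPzRingType) n (g h x : 'M[R]_n) : act (g *m h) x = act g (act h x).
Proof. by rewrite /act trmx_mul !mulmxA. Qed.

(** The orientation bounded here is the determinant of [x |-> g x g^T] on symmetric
  matrices. It is multiplicative and polynomial in [g], so [mulsign_gt0]
  applies. *)
Lemma orient_act_gt0 (R : realType) (n d : nat) (e : d.-tuple 'M[R]_n)
    (e_basis : basis_of (symmx R n) e) (g : 'M[R]_n) :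
  0 < \det g -> 0 < orient e (fun i => act g e`_i).
Proof.
case: n e e_basis g => [|n] e e_basis g.
  have d0 : d = 0%N.
    apply/eqP; rewrite -leqn0 -(dim_symmx e_basis).
    by rewrite (leq_trans (dimvS (subvf _))) // dimvf /dim /= muln0.
  subst d.
  by move=> _; rewrite /orient det_mx00 ltr01.
have eS (i : 'I_d) : e`_i \in symmx R n.+1.
  by apply: (basis_mem e_basis); rewrite mem_nth ?size_tuple.
pose P g := orient e (fun i => act g e`_i).
apply: (mulsign_gt0 (P := P)).
- rewrite /P /orient -[RHS](det1 R d); congr (\det _); apply/matrixP => i j.
  by rewrite !mxE /act mul1mx trmx1 mulmx1 coord_free ?(basis_free e_basis) // eq_sym.
- move=> A B; rewrite /P mulrC -(orient_linear e_basis) => [|i]; last exact/act_sym.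
  by rewrite /orient; congr (\det _); apply/matrixP => i j; rewrite !mxE /= actM.
move=> M.
pose Q := \matrix_(i < d, j < d) \sum_a \sum_b
   (M *m map_mx polyC e`_i *m M^T) a b * (coord e j (delta_mx a b))%:P.
exists (\det Q) => t.
rewrite -[RHS]/(horner_eval t _) -det_map_mx; congr (\det _).
apply/matrixP => i j; rewrite !mxE /= horner_evalE horner_sum.
rewrite [act _ _]matrix_sum_delta linear_sum; apply: eq_bigr => a _.
rewrite linear_sum horner_sum; apply: eq_bigr => b _.
rewrite linearZ hornerM hornerC; congr (_ * _).
suff -> : act (map_mx (horner^~ t) M) e`_i =
    map_mx (horner_eval t) (M *m map_mx polyC e`_i *m M^T) by rewrite !mxE.
rewrite !map_mxM /act map_trmx -map_mx_comp; congr (_ *m _ *m _).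
by apply/matrixP => p q; rewrite !mxE /= horner_evalE hornerC.
Qed.

(** * The line of representations of a point *)

Section Pencil.
Context (R : realFieldType) (I : finType) (V : lmodType R) (a : I -> V).

(** Geometrically: the affine space of representations of [x] as a combination
  of the [a j] meets the relative interior of the [i]-th facet of the orthant
  of nonnegative coefficients. *)
Definition in_facet (x : V) (i : I) : Prop :=
  exists c : I -> R,
    [/\ c i = 0, forall j, j != i -> 0 < c j & x = \sum_j c j *: a j].

Definition only_relation (r : I -> R) : Prop :=
  \sum_j r j *: a j = 0 /\
  forall c : I -> R, \sum_j c j *: a j = 0 -> exists s, forall j, c j = s * r j.

Lemma only_relationN r : only_relation r -> only_relation (fun j => - r j).
Proof.
case=> r0 ker; split=> [|c /ker[s cE]]; last by exists (- s) => j; rewrite cE mulrNN.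
by under eq_bigr do rewrite scaleNr; rewrite sumrN r0 oppr0.
Qed.

(** A line enters an orthant at most once: [r i > 0] says that the [i]-th
  coefficient increases along the line. *)
Lemma in_facet_uniq r x i j : only_relation r -> 0 < r i -> 0 < r j ->
  in_facet x i -> in_facet x j -> i = j.
Proof.
move=> [_ ker] ri rj [c [ci cpos xc]] [c' [c'j c'pos xc']].
apply/eqP/negPn/negP => ij.
have [|s cs] := ker (fun l => c' l - c l).
  by rewrite -[RHS](subrr x) {1}xc' xc -sumrB; apply: eq_bigr => l _; rewrite scalerBl.
have := cs i; have := cs j; rewrite ci c'j.
have := cpos j; rewrite eq_sym => /(_ ij) cj; have := c'pos i ij; nra.
Qed.

(** A line that enters the orthant leaves it as soon as some coefficient
  decreases along it. The genericity of [x] makes the exit point interior to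
  its facet. *)
Lemma in_facet_opp r x i :
    only_relation r -> (exists j, r j < 0) ->
    (forall c : I -> R, x = \sum_j c j *: a j ->
       forall p q, p != q -> c p = 0 -> c q != 0) ->
  0 < r i -> in_facet x i -> exists2 j, r j < 0 & in_facet x j.
Proof.
move=> [r0 _] [j0 rj0] gen ri [c [ci cpos xc]].
case: (@arg_minP _ _ _ j0 (fun j => r j < 0) (fun j => c j / - r j) rj0) => j rj jmin.
have ji : j != i by apply: contraTneq rj => ->; rewrite -leNgt ltW.
set s := c j / - r j in jmin.
have s0 : 0 < s by rewrite divr_gt0 ?oppr_gt0 ?cpos.
pose c' l := c l + s * r l.
have xc' : x = \sum_l c' l *: a l.
  under eq_bigr do rewrite scalerDl -scalerA.
  by rewrite big_split /= -scaler_sumr r0 scaler0 addr0.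
have c'j : c' j = 0.
  by rewrite /c' /s invrN mulrN mulNr divfK ?subrr // lt_eqF.
exists j => //; exists c'; split=> // l lj.
rewrite lt_def; apply/andP; split; first by rewrite (gen c' xc' j l) // eq_sym.
have [->|li] := eqVneq l i; first by rewrite /c' ci add0r mulr_ge0 // ltW.
have cl := cpos l li; have [rl|rl] := ltP (r l) 0; last first.
  by apply: addr_ge0; [|apply: mulr_ge0 => //]; exact: ltW.
have := jmin l rl; rewrite ler_pdivlMr ?oppr_gt0 // /c'; lra.
Qed.

(** The line either misses the orthant or enters it once and leaves it once. The
  positive weights [t] prevent it from staying inside forever, as they force
  [r] to take both signs. *)
Lemma sum_in_facet r x (t : I -> R) :
    only_relation r -> (forall j, 0 < t j) -> \sum_j r j * t j = 0 ->
    (forall c : I -> R, x = \sum_j c j *: a j ->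
       forall p q, p != q -> c p = 0 -> c q != 0) ->
  \sum_i (sgz (r i) *+ `[< in_facet x i >]) = 0.
Proof.
move=> rel t0 rt gen.
have neg (r' : I -> R) i : \sum_j r' j * t j = 0 -> 0 < r' i -> exists j, r' j < 0.
  move=> rt' ri; apply/existsP; apply: contraPT rt' => /existsPn nneg.
  rewrite (bigD1 i) //=; apply/eqP; rewrite gt_eqF // ltr_pwDl ?mulr_gt0 //.
  by apply: sumr_ge0 => j _; apply: mulr_ge0; [rewrite leNgt nneg|exact: ltW].
have rtN : \sum_j (- r j) * t j = 0.
  by under eq_bigr do rewrite mulNr; rewrite sumrN rt oppr0.
have pair i j : 0 < r i -> r j < 0 -> in_facet x i -> in_facet x j ->
    \sum_l (sgz (r l) *+ `[< in_facet x l >]) = 0.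
  move=> ri rj xi xj; have ij : i != j by apply: contraTneq ri => ->; rewrite -leNgt ltW.
  rewrite (bigD1 i) //= (bigD1 j) //=; last by rewrite eq_sym.
  rewrite big1 => [|l /andP[li lj]]; last first.
    case: asboolP => // xl; case: sgzP => // rl.
      by rewrite (in_facet_uniq rel rl ri xl xi) eqxx in li.
    rewrite -oppr_gt0 in rj; rewrite -oppr_gt0 in rl.
    by rewrite (in_facet_uniq (only_relationN rel) rl rj xl xj) eqxx in lj.
  by rewrite (gtr0_sgz ri) (ltr0_sgz rj) !asboolT.
have [[i [ri xi]]|none] := pselect (exists i, r i != 0 /\ in_facet x i); last first.
  apply: big1 => i _; case: asboolP => // xi; rewrite [r i](_ : _ = 0) ?sgz0 //.
  by apply/eqP/negPn/negP => ri; apply: none; exists i.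
move: ri; rewrite neq_lt => /orP[ri|ri].
  have ri' : 0 < - r i by rewrite oppr_gt0.
  have [j] := in_facet_opp (only_relationN rel) (neg _ _ rtN ri') gen ri' xi.
  by rewrite oppr_lt0 => rj xj; exact: (pair j i).
have [j rj xj] := in_facet_opp rel (neg _ _ rt ri) gen ri xi.
exact: (pair i j).
Qed.

End Pencil.

(** * Signed indicators of the cones of symbols *)

Section ConeSign.
Context (R : realType) (n k : nat).
Local Notation vp := (@vprime R n).

Lemma vprime_sym (v : nzcol n) : vp v \in symmx R n.
Proof. by apply/symmxP; rewrite /vprime trmx_mul trmxK. Qed.

Lemma vprime_trace_gt0 (v : nzcol n) : 0 < \tr (vp v).
Proof.
rewrite /vprime mxtrace_mulC trace_mx11; apply: sqnorm_gt0.
by rewrite map_mx_eq0 nzcol_neq0.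
Qed.

Lemma vprime_act (g : GLQ n) (v : nzcol n) :
  vp (nzcol_mul g v) = act (map_mx ratr g) (vp v).
Proof. by rewrite /vprime /act /= map_mxM trmx_mul !mulmxA. Qed.

Definition open_cone (v : symbol n k) (x : 'M[R]_n) : Prop :=
  exists2 c : 'I_(k + n) -> R, (forall i, 0 < c i) & x = \sum_i c i *: vp (v i).

(** The spans of fewer than [k + n] matrices [v'] contain all the walls of all
  the cones considered, and there are only countably many of them. *)
Definition generic (x : 'M[R]_n) : Prop :=
  forall w : seq (nzcol n), (size w < k + n)%N -> x \notin <<map vp w>>%VS.

Context (e : (k + n).-tuple 'M[R]_n) (e_basis : basis_of (symmx R n) e).

Definition cone_sign (v : symbol n k) (x : 'M[R]_n) : int :=
  sgz (orient e (vp \o v)) *+ `[< open_cone v x >].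

Lemma cone_sign_perm s v x :
  cone_sign (symbol_perm s v) x = (-1) ^+ s * cone_sign v x.
Proof.
rewrite /cone_sign mulrnAr.
have -> : orient e (vp \o symbol_perm s v) = (-1) ^+ s * orient e (vp \o v).
  rewrite /orient -det_perm -det_mulmx -row_permE; congr (\det _).
  by apply/matrixP => i j; rewrite !mxE /= ffunE.
rewrite sgzM sgzX sgzN1; congr (_ *+ nat_of_bool _); apply: asbool_equiv_eq; split=> -[c c0 xc].
  exists (c \o s^-1%g) => [i|]; first exact: c0.
  rewrite xc [RHS](reindex_inj (@perm_inj _ s)); apply: eq_bigr => i _.
  by rewrite /= permK ffunE.
exists (c \o s) => [i|]; first exact: c0.
by rewrite xc [LHS](reindex_inj (@perm_inj _ s)); apply: eq_bigr => i _; rewrite /= ffunE.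
Qed.

Lemma cone_sign_scale (a : 'I_(k + n) -> rat) (v w : symbol n k) x :
    (forall i, a i != 0) ->
    (forall i, nzcol_mx (w i) = a i *: nzcol_mx (v i)) ->
  cone_sign w x = cone_sign v x.
Proof.
move=> a0 wv; have vpE i : vp (w i) = ratr (a i) ^+ 2 *: vp (v i).
  by rewrite /vprime wv map_mxZ linearZ /= -scalemxAl -scalemxAr scalerA expr2.
have a2 i : 0 < ratr (a i) ^+ 2 :> R by rewrite exprn_even_gt0 // fmorph_eq0 a0.
rewrite /cone_sign; have -> : orient e (vp \o w) =
    (\prod_i ratr (a i) ^+ 2) * orient e (vp \o v).
  pose b := \row_i (ratr (a i) ^+ 2 : R).
  have <- : \det (diag_mx b) = \prod_i ratr (a i) ^+ 2.
    by rewrite det_diag; apply: eq_bigr => i _; rewrite mxE.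
  rewrite /orient -det_mulmx mul_diag_mx; congr (\det _); apply/matrixP => i j.
  by rewrite !mxE /= vpE linearZ.
rewrite sgzM gtr0_sgz ?prodr_gt0 // mul1r; congr (_ *+ nat_of_bool _).
apply: asbool_equiv_eq; split=> -[c c0 xc].
  exists (fun i => c i * ratr (a i) ^+ 2) => [i|]; first exact: mulr_gt0.
  by rewrite xc; apply: eq_bigr => i _; rewrite vpE scalerA.
exists (fun i => c i / ratr (a i) ^+ 2) => [i|]; first exact: divr_gt0.
by rewrite xc; apply: eq_bigr => i _; rewrite vpE scalerA divfK ?gt_eqF.
Qed.

Lemma open_cone_act (g : GLQ n) v x :
  open_cone (symbol_mul g v) (act (map_mx ratr g) x) <-> open_cone v x.
Proof.
pose h : 'M[R]_n := map_mx ratr g; have uh : h \in unitmx by rewrite map_unitmx GLQ_unit.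
have vE i : vp (symbol_mul g v i) = act h (vp (v i)) by rewrite ffunE vprime_act.
have hK y : act (invmx h) (act h y) = y.
  by rewrite -actM mulVmx // /act mul1mx trmx1 mulmx1.
split=> -[c c0 xc]; exists c => //.
  rewrite -[LHS]hK xc linear_sum; apply: eq_bigr => i _.
  by rewrite vE linearZ /= hK.
by rewrite xc linear_sum; apply: eq_bigr => i _; rewrite vE linearZ.
Qed.

Lemma cone_sign_act (g : GLQ n) v x : 0 < \det (g : 'M_n) ->
  cone_sign (symbol_mul g v) (act (map_mx ratr g) x) = cone_sign v x.
Proof.
move=> g0; rewrite /cone_sign (asbool_equiv_eq (open_cone_act g v x)); congr (_ *+ _).
have -> : orient e (vp \o symbol_mul g v) =
    orient e (act (map_mx ratr g) \o (vp \o v)).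
  by rewrite /orient; congr (\det _); apply/matrixP => i j; rewrite !mxE /= ffunE vprime_act.
rewrite (orient_linear e_basis) => [|i]; last exact: vprime_sym.
rewrite sgzM [X in _ * X]gtr0_sgz ?mulr1 //.
by apply: (orient_act_gt0 e_basis); rewrite det_map_mx ltr0q.
Qed.

Lemma generic_act (g : GLQ n) x : generic x -> generic (act (map_mx ratr g) x).
Proof.
move=> gx w ws; pose h : 'M[R]_n := map_mx ratr g.
have uh : h \in unitmx by rewrite map_unitmx GLQ_unit.
have ug : invmx g \in unitmx by rewrite unitmx_inv GLQ_unit.
have := gx [seq nzcol_mul (MkGLQ ug) v | v <- w]; rewrite size_map => /(_ ws).
apply: contra => /(memv_img (linfun (act (invmx h)))).
rewrite lfunE /= -actM mulVmx // /act mul1mx trmx1 mulmx1 limg_span -!map_comp.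
congr (_ \in <<_>>%VS); apply: eq_map => v.
have E : linfun (act (invmx h)) (vp v) = act (invmx h) (vp v) by rewrite lfunE.
by apply: (etrans E); rewrite [RHS]vprime_act [in RHS]map_invmx.
Qed.

(** The linear span of an affine subspace of dimension [d - 2] has dimension at
  most [d - 1], so the [v_i'] are linearly dependent. *)
Lemma cone_sign_flipon v x : (2 < k + n)%N -> flipon R v -> cone_sign v x = 0.
Proof.
move=> d3 [p [U [_ _ dU vU]]]; rewrite /cone_sign.
rewrite (_ : orient e _ = 0) ?sgz0 ?mul0rn //.
apply: (orient_subspace e_basis (V := (U + <[p]>)%VS)) => [i|i|].
- exact: vprime_sym.
- by rewrite /= -[vp _](subrK p) memv_add ?memv_line.
apply: leq_ltn_trans (leq_of_leqif (dimv_add_leqif U <[p]>)) _.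
rewrite dU dim_vline; apply: (@leq_ltn_trans (k + n - 2 + 1)); last by lia.
by rewrite leq_add2l leq_b1.
Qed.

End ConeSign.

Section Boundary.
Context (R : realType) (n k : nat) (e : (k + n).-tuple 'M[R]_n) (e_basis : basis_of (symmx R n) e).
Local Notation vp := (@vprime R n).

(** This is [sum_in_facet] for the relation of [orient_cramer], weighted by the
  traces of the [v_i']. *)
Lemma cone_sign_boundary (v : symbol n k.+1) x : generic k x ->
  \sum_(i < (k + n).+1) (-1) ^+ i * cone_sign e (symbol_face i v) x = 0.
Proof.
move=> gx; pose a (i : 'I_(k + n).+1) := vp (v i).
have aS i : a i \in symmx R n by exact: vprime_sym.
pose r (i : 'I_(k + n).+1) : R := (-1) ^+ i * orient e (a \o fintype.lift i).
have termE (i : 'I_(k + n).+1) : (-1) ^+ i * cone_sign e (symbol_face i v) x =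
    sgz (r i) *+ `[< in_facet a x i >].
  rewrite /cone_sign mulrnAr sgzM sgzX sgzN1; congr (_ * sgz _ *+ nat_of_bool _).
    by rewrite /orient; congr (\det _); apply/matrixP => p q; rewrite !mxE /= ffunE.
  apply: asbool_equiv_eq; split=> [[c c0 xc]|[c [ci c0 xc]]].
    exists (fun j => if unlift i j is Some l then c l else 0); split.
    - by rewrite unlift_none.
    - by move=> j; rewrite eq_sym => /unlift_some[l _ ->].
    rewrite xc (bigD1_ord i) //= unlift_none scale0r add0r.
    by apply: eq_bigr => j _; rewrite liftK ffunE.
  exists (c \o fintype.lift i) => [j|]; first by apply: c0; rewrite eq_sym neq_lift.
  rewrite xc (bigD1_ord i) //= ci scale0r add0r.
  by apply: eq_bigr => j _; rewrite ffunE.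
under eq_bigr do rewrite termE.
have r0 : \sum_i r i *: a i = 0 := orient_cramer e_basis aS.
have [/forallP rz|/forallPn[i0 ri0]] := boolP [forall i, r i == 0].
  by apply: big1 => i _; rewrite (eqP (rz i)) sgz0 mul0rn.
apply: (sum_in_facet (t := fun i => \tr (a i))).
- split=> // c ca; exists (c i0 / r i0) => j.
  have [<-|] := eqVneq i0 j; first by rewrite divfK.
  case/unlift_some => l -> _; apply/eqP; rewrite -subr_eq0; apply/eqP.
  apply: (@orient_free _ _ _ e (a \o fintype.lift i0)
     (fun l => c (fintype.lift i0 l) - c i0 / r i0 * r (fintype.lift i0 l))).
    by move: ri0; rewrite mulf_eq0 signr_eq0.
  have : \sum_j (c j - c i0 / r i0 * r j) *: a j = 0.
    under eq_bigr do rewrite scalerBl -scalerA.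
    by rewrite sumrB ca -scaler_sumr r0 scaler0 subr0.
  by rewrite (bigD1_ord i0) //= divfK // subrr scale0r add0r.
- by move=> j; exact: vprime_trace_gt0.
- by under eq_bigr do rewrite -mxtraceZ; rewrite -raddf_sum; apply: etrans (mxtrace0 R n); congr mxtrace.
move=> c xc p q pq cp; apply/eqP => cq.
pose w := [seq v l | l <- enum [pred l | (l != p) && (l != q)]].
have ws : (size w < k + n)%N.
  have : (#|[pred l | (l != p) && (l != q)]| < #|predC1 p|)%N.
    apply/proper_card/properP; split; first by apply/fintype.subsetP => l; rewrite !inE => /andP[].
    by exists q; rewrite !inE ?eqxx ?andbF // eq_sym.
  by rewrite cardC1 card_ord cardE size_map.
have /negP := gx w ws; apply; rewrite xc.
rewrite (bigID [pred l | (l != p) && (l != q)]) /= [X in _ + X]big1 => [|l].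
  rewrite addr0; apply: rpred_sum => l lpq; apply/rpredZ/memv_span/map_f/map_f.
  by rewrite mem_enum.
by rewrite negb_and !negbK => /orP[] /eqP ->; rewrite ?cp ?cq scale0r.
Qed.
End Boundary.

(** * Finiteness of the set of translates in a cone *)

Lemma clear_denoms n (u : 'rV[rat]_n) :
  exists N : int, 0 < N /\ exists z : 'rV[int]_n, map_mx intr z = N%:~R *: u.
Proof.
exists (\prod_j denq (u 0 j)); split; first by apply: prodr_gt0 => j _; exact: denq_gt0.
exists (\row_j (numq (u 0 j) * \prod_(l | l != j) denq (u 0 l))).
apply/rowP => j; rewrite !mxE [in RHS](bigD1 j) //= !intrM [RHS]mulrAC; congr (_ * _).
by rewrite -[X in _ = _ * X](divq_num_den (u 0 j)) mulrC divfK // intr_eq0 denq_neq0.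
Qed.

Lemma finite_bounded_mx n (B : nat) :
  finite_set [set g : SLZ n | forall i j, `|SLZ_mx g i j| <= B%:Z].
Proof.
pose h (t : 'M['I_(B + B).+1]_n) : SLZ n :=
  insubd (SLZ_one n) (map_mx (fun i : 'I_(B + B).+1 => (i : nat)%:Z - B%:Z) t).
apply: (@sub_finite_set _ _ (h @` [set: 'M['I_(B + B).+1]_n])%classic); last first.
  by apply: finite_image; exact: finite_finset.
move=> g gB; exists (\matrix_(i, j) inord (absz (SLZ_mx g i j + B%:Z))) => //.
apply: val_inj; rewrite /h /= insubdK.
  apply/matrixP => i j; rewrite !mxE inordK; have := gB i j; lia.
rewrite unfold_in /= (_ : map_mx _ _ = SLZ_mx g) ?SLZ_det //.
apply/matrixP => i j; rewrite !mxE inordK; have := gB i j; lia.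
Qed.

Definition intmx (R : pzRingType) m n (A : 'M[int]_(m, n)) : 'M[R]_(m, n) :=
  map_mx intr A.

Definition qform (R : pzRingType) n (x : 'M[R]_n) (z : 'cV[R]_n) : R :=
  (z^T *m x *m z) 0 0.

(** A form of positive definiteness that is visibly preserved by integer
  changes of variables. *)
Definition lattice_positive (R : realDomainType) n (x : 'M[R]_n) : Prop :=
  exists2 lam : R, 0 < lam &
    forall z : 'cV[int]_n, z != 0 -> lam <= qform x (intmx R z).

Lemma map_ratr_intr (R : numFieldType) m n (A : 'M[int]_(m, n)) :
  map_mx ratr (map_mx intr A) = intmx R A.
Proof. by apply/matrixP => i j; rewrite !mxE ratr_int. Qed.

Lemma qform_act (R : comPzRingType) n (g x : 'M[R]_n) z :
  qform (act g x) z = qform x (g^T *m z).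
Proof. by rewrite /qform /act trmx_mul trmxK !mulmxA. Qed.

Lemma qform_cone (R : realType) n m (v : 'I_m -> nzcol n) (c : 'I_m -> R) z :
  qform (\sum_i c i *: vprime R (v i)) z =
  \sum_i c i * (z^T *m map_mx ratr (nzcol_mx (v i))) 0 0 ^+ 2.
Proof.
rewrite /qform mulmx_sumr mulmx_suml summxE; apply: eq_bigr => i _.
rewrite -scalemxAr -scalemxAl mxE; congr (_ * _).
rewrite /vprime; set w := map_mx _ _; rewrite mulmxA -[_ *m w^T *m z]mulmxA.
have -> : w^T *m z = (z^T *m w)^T by rewrite trmx_mul trmxK.
by rewrite mxE big_ord1 [_^T _ _]mxE expr2.
Qed.

Lemma le_qform_act (R : realDomainType) n (x : 'M[R]_n) (lam : R) (g : SLZ n) :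
    (forall z : 'cV[int]_n, z != 0 -> lam <= qform x (intmx R z)) ->
  forall z : 'cV[int]_n, z != 0 -> lam <= qform (act (intmx R (SLZ_mx g)) x) (intmx R z).
Proof.
move=> xlam z z0.
have -> : qform (act (intmx R (SLZ_mx g)) x) (intmx R z) =
    qform x (intmx R ((SLZ_mx g)^T *m z)).
  by rewrite qform_act /intmx map_mxM map_trmx.
have ug : (SLZ_mx g)^T \in unitmx by rewrite unitmx_tr SLZ_unit.
by apply: xlam; apply: contra z0 => /eqP gz; rewrite -[z](mulKmx ug) gz mulmx0.
Qed.

Section Finiteness.
Context (R : realType) (n k : nat) (v : symbol n k).

(** Keeping the full set of row indices, with zero rows outside [J], makes the
  rank of this matrix the dimension of the span of the [v i] for [i] in [J]. *)
Definition rows_in (J : {set 'I_(k + n)}) : 'M[rat]_(k + n, n) :=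
  \matrix_(i, a) if i \in J then nzcol_mx (v i) a 0 else 0.

Lemma int_orthogonal (J : {set 'I_(k + n)}) : ~~ row_full (rows_in J) ->
  exists2 y : 'cV[int]_n, y != 0 &
    forall i, i \in J -> ((intmx R y)^T *m map_mx ratr (nzcol_mx (v i))) 0 0 = 0.
Proof.
rewrite -col_leq_rank -mxrank_tr => rk.
have : kermx (rows_in J)^T != 0.
  by rewrite kermx_eq0 -row_leq_rank.
case/rowV0Pn => u /sub_kermxP uJ u0; have [N [N0 [z zu]]] := clear_denoms u.
exists z^T => [|i iJ].
  apply: contra u0 => /eqP/(congr1 trmx); rewrite trmxK trmx0 => z0.
  move: zu; rewrite z0 map_mx0 => /esym/eqP; rewrite scaler_eq0 intr_eq0.
  by rewrite gt_eqF.
have uv : u *m nzcol_mx (v i) = 0.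
  apply/colP => j; rewrite ord1 [RHS]mxE -[RHS](_ : (u *m (rows_in J)^T) 0 i = _).
    by rewrite !mxE; apply: eq_bigr => l _; rewrite !mxE iJ.
  by rewrite uJ mxE.
have -> : (intmx R z^T)^T = map_mx ratr (N%:~R *: u).
  by rewrite -zu map_ratr_intr /intmx map_trmx trmxK.
rewrite -map_mxM -scalemxAl uv.
by rewrite scaler0 map_mx0 mxE.
Qed.

Lemma lattice_positive_spanning (x : 'M[R]_n) :
  lattice_positive x -> open_cone v x -> spanning v.
Proof.
move=> [lam lam0 xlam] [c _ xc].
have [/row_fullP[B BV]|/int_orthogonal[y y0 yv]] := boolP (row_full (rows_in [set: 'I_(k + n)])).
  rewrite /spanning eqEsubv subvf /=; apply/subvP => u _.
  have -> : u = \sum_i (u^T *m B) 0 i *: nzcol_mx (v i).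
    have : u^T = u^T *m B *m rows_in [set: 'I_(k + n)]%SET by rewrite -mulmxA BV mulmx1.
    move=> /matrixP uE; apply/colP => a; have := uE 0 a; rewrite mxE => ->.
    by rewrite mxE summxE; apply: eq_bigr => i _; rewrite !mxE inE.
  apply: rpred_sum => i _; apply/rpredZ/memv_span; exact: codom_f.
have := lt_le_trans lam0 (xlam y y0); rewrite xc qform_cone big1 ?ltxx // => i _.
by rewrite yv ?inE // expr0n mulr0.
Qed.

(** The elementary form of the Siegel property explained above. *)
Lemma finite_translates (x : 'M[R]_n) : lattice_positive x ->
  finite_set [set g : SLZ n | open_cone v (act (intmx R (SLZ_mx g)) x)].
Proof.
move=> [lam lam0 xlam].
have /choice[y yP] (J : {set 'I_(k + n)}) : exists y : 'cV[int]_n,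
    ~~ row_full (rows_in J) -> y != 0 /\ forall i, i \in J ->
      ((intmx R y)^T *m map_mx ratr (nzcol_mx (v i))) 0 0 = 0.
  have [_|/int_orthogonal[z z0 zJ]] := boolP (row_full _); first by exists 0.
  by exists z.
have /choice[A AP] (J : {set 'I_(k + n)}) : exists A : 'M[rat]_(n, k + n),
    row_full (rows_in J) -> A *m rows_in J = 1%:M.
  have [/row_fullP[B BJ]|_] := boolP (row_full (rows_in J)); first by exists B.
  by exists 0.
(* The threshold [eps] is so small that, when [v i] for [i] in [J] do not span,
   the coefficients below it contribute less than [lam] at the vector [y J]. *)
pose K J := \sum_i ((intmx R (y J))^T *m map_mx ratr (nzcol_mx (v i))) 0 0 ^+ 2.
have K0 J : 0 <= K J by apply: sumr_ge0 => i _; exact: sqr_ge0.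
pose eps := lam / (1 + \sum_J K J).
have den0 : 0 < 1 + \sum_J K J by rewrite ltr_pwDl // sumr_ge0.
have eps0 : 0 < eps by rewrite divr_gt0.
have epsK J : eps * K J < lam.
  rewrite /eps mulrAC ltr_pdivrMr // ltr_pM2l // (bigD1 J) //=.
  by rewrite addrCA ltrDl ltr_pwDl // sumr_ge0.
pose M := \sum_b (1 + `|x b b| / eps).
have M0 : 0 <= M.
  by apply: sumr_ge0 => b _; rewrite addr_ge0 // divr_ge0 // ltW.
pose Bd : R := \sum_J \sum_a \sum_i `|ratr (A J a i)| * M.
have [B BdB] : exists B : nat, Bd <= B%:R.
  exists (Num.truncn Bd).+1; exact/ltW/truncnS_gt.
apply: (@sub_finite_set _ _
  ((fun h : SLZ n => h^-1)%g @` [set h | forall i j, `|SLZ_mx h i j| <= B%:Z])%classic); last first.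
  by apply: finite_image; exact: finite_bounded_mx.
move=> g [c c0 xc]; exists g^-1%g; last by rewrite invgK.
(* The vectors whose coefficients are not tiny. *)
pose J := [set i | eps <= c i]%SET.
have Jfull : row_full (rows_in J).
  apply/negPn/negP => /yP[y0 yJ].
  have := le_qform_act g xlam y0.
  rewrite xc qform_cone leNgt => /negP; apply; apply: le_lt_trans (epsK J).
  rewrite /K mulr_sumr; apply: ler_sum => i _.
  have [iJ|] := boolP (i \in J); first by rewrite yJ // expr0n !mulr0.
  by rewrite inE -ltNge => /ltW ci; rewrite ler_wpM2r ?sqr_ge0.
pose ig := intmx R (SLZ_mx g^-1%g).
have gK z : act ig (act (intmx R (SLZ_mx g)) z) = z.
  rewrite -actM -map_mxM /= mulVmx ?SLZ_unit // map_mx1.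
  by rewrite /act mul1mx trmx1 mulmx1.
(* The rows of [U] are the [g^-1 v_i] for [i] in [J]. *)
pose U : 'M[R]_(k + n, n) := map_mx ratr (rows_in J) *m ig^T.
have igE : ig^T = map_mx ratr (A J) *m U.
  by rewrite mulmxA -map_mxM AP // map_mx1 mul1mx.
have UM i b : `|U i b| <= M.
  apply: (@le_trans _ _ (1 + `|x b b| / eps)); last first.
    rewrite /M (bigD1 b) //= lerDl; apply: sumr_ge0 => l _.
    by rewrite addr_ge0 // divr_ge0 // ltW.
  have [iJ|niJ] := boolP (i \in J); last first.
    rewrite mxE big1 => [|l _]; last by rewrite !mxE (negbTE niJ) rmorph0 mul0r.
    by rewrite normr0 addr_ge0 // divr_ge0 // ltW.
  have Ux : eps * U i b ^+ 2 <= x b b.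
    rewrite -[x]gK xc linear_sum summxE (bigD1 i) //=.
    have E l : (act ig (c l *: vprime R (v l))) b b = 
      c l * ((ig *m map_mx ratr (nzcol_mx (v l))) b 0) ^+ 2.
      rewrite linearZ mxE /=; congr (_ * _).
      rewrite /act /vprime !mulmxA -[_ *m _^T *m ig^T]mulmxA -trmx_mul mxE big_ord1.
      by rewrite [_^T _ _]mxE expr2.
    rewrite E ler_wpDr //.
      by apply: sumr_ge0 => l _; rewrite E mulr_ge0 ?sqr_ge0 // ltW.
    have -> : (ig *m map_mx ratr (nzcol_mx (v i))) b 0 = U i b.
      rewrite !mxE; apply: eq_bigr => l _; rewrite !mxE iJ; ring.
    by rewrite ler_wpM2r ?sqr_ge0 //; move: iJ; rewrite inE.
  have : U i b ^+ 2 <= `|x b b| / eps.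
    by rewrite ler_pdivlMr // mulrC (le_trans Ux) // ler_norm.
  rewrite -(real_normK (num_real (U i b))); have := normr_ge0 (U i b).
  by set t := `|U i b|; nra.
move=> a b; have igB : `|ig a b| <= Bd.
  have -> : ig a b = ig^T b a by rewrite [RHS]mxE.
  rewrite igE mxE /Bd (bigD1 J) //= (bigD1 b) //= -addrA ler_wpDr //.
    apply: addr_ge0; apply: sumr_ge0 => p _; repeat (apply: sumr_ge0 => ? _);
    by rewrite mulr_ge0.
  apply: le_trans (ler_norm_sum _ _ _) _; apply: ler_sum => i _.
  by rewrite normrM mxE ler_wpM2l.
move: (le_trans igB BdB); rewrite /ig mxE -intr_norm => H.
by rewrite -(ler_int R).
Qed.
End Finiteness.

(** * Points of a cone where the count is defined *)

HB.instance Definition _ n := [Countable of nzcol n by <:].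

Lemma finite_roots (R : rcfType) (p : {poly R}) :
  p != 0 -> finite_set [set t | root p t].
Proof.
move=> p0; apply: sub_finite_set (finite_seq (rootsR p)) => t /= pt.
by rewrite -(roots_on_rootsR p0) in_itv.
Qed.

(** A countable set has measure zero, so it does not contain an interval. *)
Lemma exists_notin_countable (R : realType) (B : set R) : countable B ->
  exists2 t, 1 <= t & ~ B t.
Proof.
move=> cB; apply: contrapT => H.
have /countable_lebesgue_measure0 : countable (`[1 : R, 2]%classic).
  apply: sub_countable cB; apply: subset_card_le => t; rewrite /= in_itv /= => /andP[t1 _].
  by apply: contrapT => Bt; apply: H; exists t.
rewrite lebesgue_measure_itv /= lte_fin ltr1n /=.
by move=> /eqP; rewrite -EFinB eqe => /eqP; lra.
Qed.

(** The point [x t] runs along a moment curve in the open cone. It meets a proper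
  subspace only at the roots of a nonzero polynomial in [t], hence all the
  countably many walls together only for countably many [t]. The bound
  [1 <= c i] serves [cone_lattice_positive]. *)
Lemma generic_in_cone (R : realType) (n k : nat) (e : (k + n).-tuple 'M[R]_n)
    (e_basis : basis_of (symmx R n) e) (v : symbol n k) :
    orient e (vprime R (n := n) \o v) != 0 ->
  exists2 c : 'I_(k + n) -> R, (forall i, 1 <= c i) &
    generic k (\sum_i c i *: vprime R (v i)).
Proof.
move=> v0; pose x (t : R) := \sum_(i < k + n) t ^+ i *: vprime R (v i).
pose bad (w : seq (nzcol n)) := [set t | (size w < k + n)%N /\
  x t \in <<map (vprime R (n := n)) w>>%VS]%classic.
have cbad w : countable (bad w).
  have [ws|/negP ws] := boolP (size w < k + n)%N; last first.
    by apply: (@sub_countable _ _ _ set0) => //; apply: subset_card_le => t [].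
  set V := <<map (vprime R (n := n)) w>>%VS.
  have [i iV] : exists i, vprime R (v i) \notin V.
    apply/existsP; apply: contraNT v0 => /existsPn vV; apply/eqP.
    apply: (orient_subspace e_basis (V := V)) => [i|i|].
    - exact: vprime_sym.
    - by rewrite -[_ \in _]negbK vV.
    - by apply: leq_ltn_trans (dim_span _) _; rewrite size_map.
  pose f : 'M[R]_n -> 'M[R]_n := fun y => y - projv V y.
  have fV y : (y \in V) = (f y == 0).
    rewrite /f subr_eq0; apply/idP/eqP => [yV|->]; first by rewrite projv_id.
    exact: memv_proj.
  have := iV; rewrite fV => /matrix0Pn[a [b fab]].
  pose p := \poly_(j < k + n) (if insub j is Some l then f (vprime R (v l)) a b else 0).
  have pE t : p.[t] = f (x t) a b.
    rewrite horner_poly /f !mxE linear_sum !summxE -sumrB; apply: eq_bigr => l _.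
    by rewrite valK linearZ !mxE mulrC mulrBr.
  apply/finite_set_countable/(sub_finite_set (B := [set t | root p t]%classic)).
    by move=> t [_ xV]; rewrite /= rootE pE; move: xV; rewrite fV => /eqP ->; rewrite mxE.
  apply: finite_roots; apply: contra fab => /eqP/(congr1 (fun q : {poly R} => q`_i)).
  by rewrite coef_poly ltn_ord valK coef0 => ->.
have [t t1 tB] := exists_notin_countable (bigcup_countable (countableP setT) (fun w _ => cbad w)).
exists (fun i : 'I_(k + n) => t ^+ i) => [i|w ws]; first exact: exprn_ege1.
by apply/negP => xw; apply: tB; exists w.
Qed.

(** At an integer vector [y] the form is [\sum_i c_i (y . v_i) ^ 2]. The [v_i]
  span, so some [y . v_i] is nonzero, and it is at least [1 / N] in absolute
  value if [N] is a common denominator of all their entries. *)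
Lemma cone_lattice_positive (R : realType) (n k : nat) (e : (k + n).-tuple 'M[R]_n)
    (e_basis : basis_of (symmx R n) e) (v : symbol n k) (c : 'I_(k + n) -> R) :
    orient e (vprime R (n := n) \o v) != 0 -> (forall i, 1 <= c i) ->
  lattice_positive (\sum_i c i *: vprime R (v i)).
Proof.
move=> v0 c1.
pose Vm : 'rV[rat]_((k + n) * n) := mxvec (\matrix_(i < k + n, a < n) nzcol_mx (v i) a 0).
have [N [N0 [z zV]]] := clear_denoms Vm.
have NR : 0 < (N%:~R : R) by rewrite ltr0z.
exists (N%:~R ^- 2) => [|y y0]; first by rewrite invr_gt0 exprn_gt0.
rewrite qform_cone.
pose s (i : 'I_(k + n)) : R := ((intmx R y)^T *m map_mx ratr (nzcol_mx (v i))) 0 0.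
have [i si] : exists i, s i != 0.
  apply/existsP; apply: contraNT y0 => /existsPn s0; apply/eqP.
  have S1 : 1%:M \in symmx R n by apply/symmxP; rewrite trmx1.
  have [d dE] := orient_span e_basis (fun i => vprime_sym R (v i)) v0 S1.
  have : qform 1%:M (intmx R y) = 0.
    rewrite dE qform_cone big1 // => i _.
    by have := s0 i; rewrite negbK => /eqP si; rewrite -/(s i) si expr0n mulr0.
  rewrite /qform mulmx1; case: (eqVneq (intmx R y) 0) => [/matrixP yz _|/sqnorm_gt0].
    apply/matrixP => a b; have /eqP := yz a b.
    by rewrite !mxE intr_eq0 => /eqP.
  by move=> /[swap] ->; rewrite ltxx.
have [m sm] : exists m : int, N%:~R * s i = m%:~R.
  exists (\sum_a y a 0 * vec_mx z i a).
  have zE a : ((vec_mx z i a)%:~R : R) = N%:~R * ratr (nzcol_mx (v i) a 0).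
    have := congr1 (fun M => vec_mx M i a) zV; rewrite -map_vec_mx linearZ /= mxvecK !mxE.
    by move=> /(congr1 (@ratr R)); rewrite rmorphM /= !ratr_int.
  rewrite /s mxE mulr_sumr rmorph_sum; apply: eq_bigr => a _.
  rewrite /= intrM zE !mxE; ring.
have m0 : m != 0.
  by rewrite -(intr_eq0 R) -sm mulf_neq0 // gt_eqF.
have m1 : 1 <= (m%:~R : R) ^+ 2.
  by rewrite -rmorphXn /= ler1z -gtz0_ge1 exprn_even_gt0.
rewrite (bigD1 i) //= -/(s i) -[leLHS]addr0; apply: lerD; last first.
  by apply: sumr_ge0 => j _; rewrite mulr_ge0 ?sqr_ge0 // (le_trans ler01).
apply: (@le_trans _ _ (s i ^+ 2)); last by rewrite ler_peMl // sqr_ge0.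
by rewrite -div1r ler_pdivrMr ?exprn_gt0 // -exprMn mulrC sm.
Qed.

(** * The counting cosharbly *)

Section OrbitCount.
Context (R : realType) (n k : nat) (e : (k + n).-tuple 'M[R]_n)
  (e_basis : basis_of (symmx R n) e).
Context (G : {pred SLZ n}) (G_subgroup : group_closed G).
Local Notation vp := (@vprime R n).

Definition slz_act (g : SLZ n) : 'M[R]_n -> 'M[R]_n := act (intmx R (SLZ_mx g)).

Lemma slz_actE (g : SLZ n) : slz_act g = act (map_mx ratr (SLZ_GLQ g : 'M_n)).
Proof. by rewrite /slz_act /= map_ratr_intr. Qed.

Lemma slz_actM (g h : SLZ n) x : slz_act (g * h)%g x = slz_act g (slz_act h x).
Proof. by rewrite /slz_act -actM /intmx -map_mxM. Qed.

Definition admissible (x : 'M[R]_n) : Prop := lattice_positive x /\ generic k x.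

Definition orbit_sum (v : symbol n k) (x : 'M[R]_n) : rat :=
  \sum_(g \in [set g | g \in G]%classic) ((cone_sign e v (slz_act g x))%:~R : rat).

(** Admissibility makes the sum finite, respects the sharbly relations and gives
  the cocycle condition; the value [0] elsewhere satisfies all this trivially. The target
  [rat^o] carries the structure of a vector space over [rat]. *)
Definition orbit_count (v : symbol n k) : 'M[R]_n -> rat^o :=
  fun x => if `[< admissible x >] then orbit_sum v x else 0.

Lemma orbit_sum_fset (v : symbol n k) (x : 'M[R]_n) (D : {fset SLZ n}) :
    {subset D <= G} ->
    (forall g, g \in G -> cone_sign e v (slz_act g x) != 0 -> g \in D) ->
  orbit_sum v x = \sum_(g <- D) (cone_sign e v (slz_act g x))%:~R.
Proof.
move=> DG supp; rewrite /orbit_sum (fsbigE (D : seq _)) ?fset_uniq //.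
- rewrite big_seq_cond [RHS]big_seq; apply: eq_bigl => g.
  by case gD: (g \in D) => //=; apply/mem_set/DG.
- by move=> g /= gG gD; apply/eqP; rewrite intr_eq0; apply: contraNT gD; exact: supp.
Qed.

(** One finite set of indices for finitely many symbols, so that sums over [g]
  and over these symbols can be exchanged. *)
Lemma cone_sign_supp (I : finType) (v : I -> symbol n k) x : lattice_positive x ->
  exists D : {fset SLZ n}, {subset D <= G} /\
    forall i g, g \in G -> cone_sign e (v i) (slz_act g x) != 0 -> g \in D.
Proof.
move=> xl.
pose T i := ([set g | g \in G] `&` [set g | open_cone (v i) (slz_act g x)])%classic.
have finT : finite_set (\bigcup_i T i)%classic.
  apply: bigcup_finite => // i _.
  by apply: sub_finite_set (finite_translates (v i) xl) => g [].
exists (fset_set (\bigcup_i T i)%classic); split=> [g|i g gG].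
  by rewrite in_fset_set // inE => -[i _ [gG _]].
rewrite in_fset_set // inE /cone_sign; case: asboolP => [gv _|]; last by rewrite mulr0n eqxx.
by exists i.
Qed.

Lemma orbit_count_rel x : sharbly_rel x -> free_lift orbit_count x = 0.
Proof.
case=> {x} [s v|v vs|a v w a0 vw].
- rewrite raddfB [X in _ - X]linearZ /= !free_lift_gen; apply/eqP.
  rewrite subr_eq0; apply/eqP/funext => x; rewrite [RHS]/GRing.scale /=.
  rewrite /orbit_count; case: asboolP => [[xl _]|]; last by rewrite scaler0.
  have [D [DG suppD]] := cone_sign_supp (fun s : 'S_(k + n) => symbol_perm s v) xl.
  have v1 : v = symbol_perm 1 v by apply/ffunP => i; rewrite ffunE perm1.
  rewrite (orbit_sum_fset DG (suppD s)) {2}v1 (orbit_sum_fset DG (suppD 1%g)).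
  rewrite scaler_sumr; apply: eq_bigr => g _.
  by rewrite -v1 cone_sign_perm intrM rmorphXn rmorphN1.
- rewrite free_lift_gen; apply/funext => x; rewrite /orbit_count.
  case: asboolP => // -[[lam lam0 xlam] _]; apply: fsbig1 => g gG.
  rewrite /cone_sign; case: asboolP => // gv; case/negP: vs.
  by apply: lattice_positive_spanning gv; exists lam => //; exact: le_qform_act.
- rewrite raddfB /= !free_lift_gen; apply/eqP; rewrite subr_eq0; apply/eqP.
  apply/funext => x; rewrite /orbit_count; case: ifP => // _.
  apply: eq_fsbigr => g _; congr (_%:~R); apply/esym.
  apply: (cone_sign_scale e (a := fun i => if (i : nat) == 0%N then a else 1)) => i.
    by case: ifP => // _; exact: oner_neq0.
  by rewrite vw; case: ifP => // _; rewrite scale1r.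
Qed.

Definition orbit_cosharbly : Sh n k -> ('M[R]_n -> rat^o) := modquot_lift orbit_count_rel.

HB.instance Definition _ := GRing.Linear.on orbit_cosharbly.

Lemma orbit_cosharbly_basic v : orbit_cosharbly (basic v) = orbit_count v.
Proof. by rewrite /orbit_cosharbly /basic modquot_lift_pi /= free_lift_gen. Qed.

Lemma orbit_count_act (h : SLZ n) v : h \in G ->
  orbit_count (symbol_mul (SLZ_GLQ h) v) = orbit_count v.
Proof.
move=> hG; apply/funext => x; rewrite /orbit_count; case: ifP => // _.
rewrite /orbit_sum (reindex_fsbig (fun g => h * g)%g [set g | g \in G]%classic).
  apply: eq_fsbigr => g _; rewrite slz_actM slz_actE cone_sign_act //.
  by rewrite /= det_map_mx (eqP (SLZ_det h)) rmorph1 ltr01.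
split=> [g gG|g1 g2 _ _|g gG].
- exact: (group_closedM G_subgroup).
- exact: mulgI.
have hVG := group_closedV G_subgroup hG.
by exists (h^-1 * g)%g; [exact: (group_closedM G_subgroup hVG gG)|exact: mulVKg].
Qed.

Lemma orbit_cosharbly_invariant : cosharbly G orbit_cosharbly.
Proof.
move=> h hG q; have [x ->] := to_modquot_surj q.
rewrite /=; have -> : orbit_cosharbly (to_modquot _ x) = \sum_(v <- dom x) coeff v x *: orbit_count v.
  by rewrite /orbit_cosharbly modquot_lift_pi /= free_liftE.
have -> : sharbly_act (SLZ_GLQ h) (to_modquot _ x) =
    \sum_(v <- dom x) coeff v x *: basic (symbol_mul (SLZ_GLQ h) v).
  by rewrite /sharbly_act modquot_lift_pi /= free_liftE.
rewrite linear_sum; apply: eq_bigr => v _.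
by rewrite linearZ /= orbit_cosharbly_basic orbit_count_act.
Qed.

Lemma orbit_cosharbly_cocycle : cocycle orbit_cosharbly.
Proof.
move=> v; rewrite boundary_basic linear_sum; apply/funext => x.
rewrite fct_sumE.
under eq_bigr do rewrite linearZ /= orbit_cosharbly_basic.
rewrite /GRing.scale /= /orbit_count; case: asboolP => [[xl xg]|_]; last first.
  by apply: big1 => i _; rewrite scaler0.
have [D [DG suppD]] := cone_sign_supp (fun i : 'I_(k + n).+1 => symbol_face i v) xl.
under eq_bigr do rewrite (orbit_sum_fset DG (suppD _)) scaler_sumr.
rewrite exchange_big /= big1 // => g _.
transitivity ((\sum_(i < (k + n).+1) (-1) ^+ i *
    cone_sign e (symbol_face i v) (slz_act g x))%:~R : rat).
  by rewrite rmorph_sum; apply: eq_bigr => i _; rewrite rmorphM rmorphXn rmorphN1.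
rewrite cone_sign_boundary // slz_actE; exact: generic_act.
Qed.

Lemma orbit_count_flipon v x : (2 < k + n)%N -> flipon R v -> orbit_count v x = 0.
Proof.
move=> d2 vf; rewrite /orbit_count; case: ifP => // _; apply: fsbig1 => g _.
by rewrite cone_sign_flipon.
Qed.

Lemma orbit_count_ge0 (v : symbol n k) x : 0 < orient e (vp \o v) -> 0 <= orbit_count v x.
Proof.
move=> v0; rewrite /orbit_count; case: ifP => // _; apply: fsumr_ge0 => g _.
by rewrite ler0z mulrn_wge0 // sgz_ge0 ltW.
Qed.

Lemma orbit_count_gt0 (v : symbol n k) x : 0 < orient e (vp \o v) -> admissible x ->
  open_cone v x -> 0 < orbit_count v x.
Proof.
move=> v0 xa vx; rewrite /orbit_count asboolT //.
have [D [DG suppD]] := cone_sign_supp (fun _ : unit => v) xa.1.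
have s1 : cone_sign e v (slz_act 1%g x) = 1.
  by rewrite /slz_act /intmx /= map_mx1 /act mul1mx trmx1 mulmx1 /cone_sign asboolT // gtr0_sgz.
have D1 : 1%g \in D by apply: (suppD tt); [case: G_subgroup|rewrite s1].
rewrite (orbit_sum_fset DG (suppD tt)) (bigD1_seq 1%g) ?fset_uniq // s1 ltr_pwDl //.
by apply: sumr_ge0 => g _; rewrite ler0z mulrn_wge0 // sgz_ge0 ltW.
Qed.

End OrbitCount.

Theorem theorem6p2 (R : realType) (n : nat) (n_ge2 : (2 <= n)%N)
    (G : {pred SLZ n}) (G_subgroup : group_closed G)
    (G_index : finite_index G)
    (e : (tdeg n + n).-tuple 'M[R]_n) (e_basis : basis_of (symmx R n) e) :
  exists (E : lmodType rat) (mu : {linear Sh n (tdeg n) -> E}),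
    [/\ cosharbly G mu, cocycle mu &
      forall (p q : nat) (lambda : 'I_p -> rat) (s : 'I_p -> set 'M[R]_n)
          (cs : 'I_p -> Sh n (tdeg n))
          (kappa : 'I_q -> rat) (w : 'I_q -> symbol n (tdeg n)),
        (0 < p)%N ->
        (forall i, 0 < lambda i) ->
        (forall i, cone_sharbly e (s i) (cs i)) ->
        (forall j, flipon R (w j)) ->
        mu (\sum_(i < p) lambda i *: cs i
            + \sum_(j < q) kappa j *: basic (w j)) != 0].
Proof.
have d3 : (2 < tdeg n + n)%N.
  by rewrite tdeg_dim; case: n n_ge2 {G G_subgroup G_index e e_basis} => [|[|n]] //; lia.
exists ('M[R]_n -> rat^o), (orbit_cosharbly e G); split.
- exact (orbit_cosharbly_invariant e_basis G_subgroup).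
- exact (orbit_cosharbly_cocycle e_basis G).
move=> p q lambda s cs kappa w p0 lambda0 csP wP.
pose i0 := Ordinal p0; have [v [_ v0 csv]] := csP i0.
have v0' : orient e (@vprime R n \o v) != 0 by rewrite gt_eqF.
have [c c1 xgen] := generic_in_cone e_basis v0'.
set x := \sum_i _ in xgen.
have xa : admissible (tdeg n) x.
  by split=> //; exact: cone_lattice_positive e_basis _ _ v0' c1.
have vx : open_cone v x by exists c => // i; apply: lt_le_trans (c1 i).
apply/eqP => /(congr1 (fun f => f x)).
suff : 0 < orbit_cosharbly e G (\sum_(i < p) lambda i *: cs i
            + \sum_(j < q) kappa j *: basic (w j)) x.
  by move=> /[swap] ->; rewrite ltxx.
rewrite linearD !linear_sum [X in _ + X]big1 => [|j _]; last first.
  rewrite linearZ /= orbit_cosharbly_basic; apply/funext => y.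
  by rewrite [LHS]/GRing.scale /= orbit_count_flipon // scaler0.
rewrite addr0 fct_sumE.
have valE i y : orbit_cosharbly e G (lambda i *: cs i) y =
    lambda i * orbit_cosharbly e G (cs i) y by rewrite linearZ.
rewrite (bigD1 i0) //= ltr_pwDl //.
  by rewrite valE mulr_gt0 // csv orbit_cosharbly_basic orbit_count_gt0.
apply: sumr_ge0 => i _; rewrite valE mulr_ge0 ?(ltW (lambda0 i)) //.
by have [u [_ u0 ->]] := csP i; rewrite orbit_cosharbly_basic orbit_count_ge0.
Qed.
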